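(* Let $L$ be a geometric lattice of rank $r$, let $\mathcal F=\{\hat 0=F_0<F_1<\cdots<F_r=\hat 1\}$ be a complete flag (maximal chain) in $L$, and let $S_G=S_G(\mathcal F)$, $G\in L$, be the simplicial complexes associated to $\mathcal F$ as defined in the context. Then: 1. $(S_{\hat 0},\{S_G: G \text{ an atom of } L\})$ is a homotopy $(r-1)$-arrangement. 2. For every $G\in L$, $S_G\simeq S^{\operatorname{corank}(G)-1}$, where $\operatorname{corank}(G)=r-\operatorname{rank}(G)$. 3. For every $G,H\in L$, $S_G\cap S_H=S_{G\vee H}$.
   Context: A geometric lattice is a finite ranked lattice $L$ (least element $\hat 0$, greatest element $\hat 1$) in which every element is a join of atoms and $\operatorname{rank}(X)+\operatorname{rank}(Y)\ge \operatorname{rank}(X\wedge Y)+\operatorname{rank}(X\vee Y)$ for all $X,Y$. For $X\in L$, $\operatorname{coat}(X)$ denotes the set of coatoms of $L$ that are $\ge X$ (so $\operatorname{coat}(\hat 1)=\emptyset$). Construction. Given the complete flag $\mathcal F$, put $A_i=\operatorname{coat}(F_i)\setminus \operatorname{coat}(F_{i+1})$ for $i=0,\dots,r-1$; the sets $A_0,\dots,A_{r-1}$ partition the set of coatoms of $L$. Take two vertices $H_+,H_-$ for each coatom $H$ of $L$. For $G\in L$, $S_G=S_G(\mathcal F)$ is the simplicial complex whose maximal simplices are the sets $W_0\cup\cdots\cup W_{r-1}$, where for each $i$ independently, $W_i$ is either $\{H_+:H\in\operatorname{coat}(G)\cap A_i\}$ or $\{H_-:H\in\operatorname{coat}(G)\cap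 A_i\}$ (both are empty if $\operatorname{coat}(G)\cap A_i=\emptyset$). In particular $S_{\hat 1}=\emptyset$, and every $S_G$ is a subcomplex of $S_{\hat 0}$. A homotopy $d$-arrangement is a simplicial complex $S$ together with a finite set $\mathcal A$ of subcomplexes of $S$ such that: (i) $S\simeq S^d$; (ii) each $T\in\mathcal A$ is homotopy equivalent to $S^{d-1}$; (iii) every intersection of elements of $\mathcal A$ is homotopy equivalent to a sphere; (iv) there is a free $\mathbb Z_2$ action on $S$ that restricts to an action on each $T\in\mathcal A$; (v) if $U\simeq S^{d'}$ is an intersection of elements of $\mathcal A$ and $T\in\mathcal A$ satisfies $U\not\subseteq T$, then $U\cap T\simeq S^{d'-1}$. Convention: $S^{-1}=\emptyset$, and the complex with no vertices is regarded as $S^{-1}$. *)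

(* Defs.v *)
From HB Require Import structures.
From mathcomp Require Import all_boot all_order all_fingroup all_algebra.
From mathcomp Require Import all_classical all_reals all_analysis.

Set Implicit Arguments.
Unset Strict Implicit.
Unset Printing Implicit Defensive.

Import Order.TTheory GRing.Theory Num.Theory.
Import numFieldNormedType.Exports.

Local Open Scope classical_set_scope.
Local Open Scope ring_scope.

Section GeometricLattice.
Context {d : Order.disp_t} {L : finTBLatticeType d}.
Implicit Types (x y z : L) (rk : L -> nat).

Definition covers x y : bool :=
  (x < y)%O && [forall z : L, ~~ ((x < z)%O && (z < y)%O)].

Definition atoms : {set L} := [set x | covers \bot%O x]%SET.

Definition coatoms : {set L} := [set x | covers x \top%O]%SET.

Definition coat x : {set L} := [set H in coatoms | (x <= H)%O]%SET.

Definition is_rank rk : Prop :=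
  rk \bot%O = 0%N /\ forall x y, covers x y -> rk y = (rk x).+1.

(* On a finite lattice there is at most one function [rk] with [is_rank rk]. *)
Definition geometric_lattice rk : Prop :=
  [/\ is_rank rk,
      forall x, exists2 B : {set L}, B \subset atoms & x = (\join_(a in B) a)%O
    & forall x y, (rk (x `&` y)%O + rk (x `|` y)%O <= rk x + rk y)%N].

(* A maximal chain, listed in increasing order from bottom to top. *)
Definition complete_flag (r : nat) (F : 'I_r.+1 -> L) : Prop :=
  [/\ F ord0 = \bot%O, F ord_max = \top%O,
      forall i j : 'I_r.+1, (i < j)%N -> (F i < F j)%O
    & forall z, (forall i, (z >=< F i)%O) -> exists i, z = F i].

(* [widen_ord (leqnSn r) i] and [lift ord0 i] are i and i + 1 in 'I_r.+1. *)
Definition flag_block (r : nat) (F : 'I_r.+1 -> L) (i : 'I_r) : {set L} :=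
  (coat (F (widen_ord (leqnSn r) i)) :\: coat (F (lift ord0 i)))%SET.

(* The vertices H_+ and H_- are (H, true) and (H, false) for H a coatom; the
   other elements of L * bool belong to no simplex. *)
Definition flag_facet (r : nat) (F : 'I_r.+1 -> L) (G : L)
    (e : {ffun 'I_r -> bool}) : {set L * bool} :=
  (\bigcup_(i < r) [set (H, e i) | H in coat G :&: flag_block F i])%SET.

Definition flag_complex (r : nat) (F : 'I_r.+1 -> L) (G : L) :
    {set {set L * bool}} :=
  [set s : {set L * bool} |
    [exists e : {ffun 'I_r -> bool}, s \subset flag_facet F G e]]%SET.

End GeometricLattice.

(* A finite simplicial complex is its set of simplices, the empty simplex
   included; a point of V is a vertex only if its singleton is a simplex. *)
Definition simplicial_complex (V : finType) (K : {set {set V}}) : Prop :=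
  ((finset.set0 : {set V}) \in K) /\
  forall s t : {set V}, s \in K -> t \subset s -> t \in K.

Definition subcomplex (V : finType) (K' K : {set {set V}}) : Prop :=
  simplicial_complex K' /\ K' \subset K.

(* Geometric realization, in barycentric coordinates; it is empty when the only
   simplex is the empty one. *)
Definition realization (R : realType) (V : finType) (K : {set {set V}}) :
    set {ptws V -> R} :=
  [set x : {ptws V -> R} |
    [/\ forall v, 0 <= x v, \sum_v x v = 1 & [set v | x v != 0]%SET \in K]].
Arguments realization R {V} K.

(* The sphere of dimension n - 1; it is empty when n = 0. *)
Definition unit_sphere (R : realType) (n : nat) : set 'rV[R]_n :=
  [set x : 'rV[R]_n | \sum_(i < n) x ord0 i ^+ 2 = 1].
Arguments unit_sphere R n : clear implicits.

Definition homotopic (R : realType) (X Y : topologicalType) (f g : X -> Y) :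
    Prop :=
  exists h : R * X -> Y,
    [/\ {within `[0, 1]%classic `*` [set: X], continuous h},
        forall x, h (0, x) = f x & forall x, h (1, x) = g x].

Definition homotopy_equivalent (R : realType) (X Y : topologicalType) : Prop :=
  exists (f : X -> Y) (g : Y -> X),
    [/\ continuous f, continuous g,
        homotopic R (g \o f) idfun & homotopic R (f \o g) idfun].

(* There is no sphere of dimension m < -1. *)
Definition homotopy_sphere (R : realType) (V : finType) (K : {set {set V}})
    (m : int) : Prop :=
  exists2 n : nat, m = n%:Z - 1 &
    homotopy_equivalent R (realization R K) (unit_sphere R n).

(* An action by simplicial automorphisms, free on the realization of S: the
   point with coordinates x is moved by g to the one with coordinates
   v |-> x (v g^-1). *)
Definition free_Z2_action (R : realType) (V : finType) (S : {set {set V}})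
    (to : {action 'Z_2 &-> V}) : Prop :=
  [acts [set: 'Z_2]%SET, on S | to^*] /\
  forall (g : 'Z_2) (x : {ptws V -> R}),
    g != 1%g -> realization R S x -> (fun v => x (to v g^-1%g)) <> x.

(* The intersection of the empty family is S itself. *)
Definition intersection_in (V : finType) (S : {set {set V}})
    (B : {set {set {set V}}}) : {set {set V}} :=
  (S :&: \bigcap_(T in B) T)%SET.

Definition homotopy_arrangement (R : realType) (V : finType) (m : int)
    (S : {set {set V}}) (A : {set {set {set V}}}) : Prop :=
  [/\ simplicial_complex S,
      forall T : {set {set V}}, T \in A -> subcomplex T S
    & [/\ homotopy_sphere R S m,
          forall T : {set {set V}}, T \in A -> homotopy_sphere R T (m - 1),
          forall B : {set {set {set V}}}, B \subset A ->
            exists k : int, homotopy_sphere R (intersection_in S B) k,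
          exists2 to : {action 'Z_2 &-> V}, free_Z2_action R S to &
            forall T : {set {set V}}, T \in A ->
              [acts [set: 'Z_2]%SET, on T | to^*]
        & forall (B : {set {set {set V}}}) (T : {set {set V}}) (k : int),
            B \subset A -> T \in A ->
            homotopy_sphere R (intersection_in S B) k ->
            ~~ (intersection_in S B \subset T) ->
            homotopy_sphere R (intersection_in S B :&: T)%SET (k - 1)]].

(* Main.v *)
Require Import Defs.
From mathcomp Require Import all_boot all_order all_fingroup all_algebra.
From mathcomp Require Import all_classical all_reals all_analysis.
From mathcomp Require Import zify ring lra.

Set Implicit Arguments.
Unset Strict Implicit.
Unset Printing Implicit Defensive.

Import Order.TTheory GRing.Theory Num.Theory.
Import numFieldNormedType.Exports.
Local Open Scope classical_set_scope.
Local Open Scope ring_scope.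

(** Each S_G is the boundary of a cross-polytope with fattened vertices: it is the
    join, over the blocks A_i that meet coat(G), of two disjoint simplices.  A
    point is determined up to a straight-line homotopy by its signed block
    masses, so S_G is a sphere of dimension one less than the number of blocks
    that meet coat(G).  The block A_i misses coat(G) exactly when
    G v F_i = G v F_{i+1}, because elements are separated by coatoms, and by
    semimodularity the rank of G v F_i increases by at most one at each step;
    hence r - rank(G) blocks meet coat(G).

    Condition (v) fixes U only up to homotopy, so it needs the invariance of
    dimension for spheres.  If m < n and the identity of the unit sphere of R^n
    were homotopic to a map g o f through the unit sphere of R^m, label a point of
    the sphere by its first negative coordinate, and label the cube [-1, 1]^n
    along the homotopy near its boundary and, inside, through a partition of R^m
    into small bricks of which at most m + 1 meet near any point.  No point of the
    cube has all n + 1 labels nearby, against Sperner's lemma. *)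

(** * Counting rainbow staircase paths modulo 2 *)

Section GridSperner.
Variables (n : nat) (lab : {ffun 'I_n -> nat} -> 'I_n.+1).
Implicit Types (x : {ffun 'I_n -> nat}) (S : {set 'I_n}) (A : {set 'I_n.+1}).

Definition grid_step (s : 'I_n) x : {ffun 'I_n -> nat} :=
  [ffun i => (x i + (i == s))%N].

Lemma grid_stepC s t x : grid_step s (grid_step t x) = grid_step t (grid_step s x).
Proof. by apply/ffunP=> i; rewrite !ffunE addnAC. Qed.

(* The parity of the number of orderings of the k directions in S for which the
   k + 1 vertices of the staircase path from x carry each label in A once. *)
Fixpoint rainbow_paths (k : nat) S A x : 'F_2 :=
  if k is k'.+1 then
    (lab x \in A)%:R *
      \sum_(s in S) rainbow_paths k' (S :\ s) (A :\ lab x) (grid_step s x)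
  else (A == [set lab x]%SET)%:R.

Lemma addrr_F2 (a : 'F_2) : a + a = 0.
Proof. by apply: addrr_pchar2; exact: pchar_Fp. Qed.

(** Each unordered pair contributes twice, hence nothing modulo 2; the induction splits off one
    element [a] with its row and its column. *)
Lemma sum_offdiag_F2 (T : finType) (S : {set T}) (F : T -> T -> 'F_2) :
  (forall s t, F s t = F t s) ->
  \sum_(s in S) \sum_(t in S :\ s) F s t = 0.
Proof.
move=> Fsym; have [k] := ubnP #|S|; elim: k S => // k IH S.
have [->|[a aS]] := set_0Vmem S; first by rewrite big_set0.
rewrite (cardsD1 a) aS ltnS add1n => Sk.
rewrite (big_setD1 a aS) /=.
under [X in _ + X]eq_bigr => s /finset.setD1P[sa sS].
  rewrite (big_setD1 a); last by rewrite finset.in_setD1 eq_sym sa.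
  rewrite /= (_ : S :\ s :\ a = S :\ a :\ s)%SET; last first.
    by apply/setP=> z; rewrite !inE; case: (z == a); case: (z == s).
  over.
rewrite big_split /= IH // addr0.
by under eq_bigr => s _ do rewrite Fsym; rewrite addrr_F2.
Qed.

(* The faces labelled A of the paths in the directions S, counted in two ways:
   an inner vertex can be skipped in two orders, so only the faces that omit the
   first or the last vertex survive modulo 2. *)
Lemma rainbow_paths_boundary k S A x : #|S| = k.+1 -> #|A| = k.+1 ->
  \sum_(b in ~: A) rainbow_paths k.+1 S (b |: A) x =
  \sum_(s in S) (rainbow_paths k (S :\ s) A (grid_step s x)
                 + rainbow_paths k (S :\ s) A x).
Proof.
elim: k S A x => [|k IH] S A x Sk Ak.
  have /cards1P[s ->] : #|S| == 1%N by rewrite Sk.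
  have /cards1P[a ->] : #|A| == 1%N by rewrite Ak.
  rewrite big_set1 /=.
  under eq_bigr do rewrite big_set1.
  have [xa|xa] := eqVneq (lab x) a.
    rewrite xa eqxx.
    transitivity (\sum_(b in ~: [set a]%SET) (lab (grid_step s x) == b)%:R : 'F_2).
      apply: eq_bigr => b; rewrite !inE => ba.
      rewrite eqxx orbT mul1r; congr (_%:R); congr nat_of_bool.
      have -> : ((b |: [set a]) :\ a = [set b])%SET.
        apply/setP=> z; rewrite !inE.
        by have [->|] //= := eqVneq z a; rewrite ?orbF // eq_sym (negbTE ba).
      apply/eqP/eqP => [/setP/(_ b)|->//].
      by rewrite !inE eqxx => /esym/eqP ->.
    have [ya|ya] := eqVneq (lab (grid_step s x)) a.
      rewrite ya eqxx addrr_F2 big1 // => b; rewrite !inE eq_sym => /negbTE -> //.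
    rewrite (bigD1 (lab (grid_step s x))) ?inE //= eqxx big1 ?addr0.
      rewrite (_ : (_ == _) = false) ?add0r //.
      apply/negbTE; apply: contra_neq ya => /setP/(_ a); rewrite !inE eqxx.
      by move/esym/eqP.
    by move=> b /andP[_]; rewrite eq_sym => /negbTE ->.
  have -> : ([set a] == [set lab x])%SET = false.
    apply/negbTE; apply: contra_neq xa => /setP/(_ a); rewrite !inE eqxx.
    by move/esym/eqP.
  rewrite addr0 (bigD1 (lab x)) ?inE //= eqxx mul1r big1 ?addr0.
    congr (_%:R); congr nat_of_bool; congr (_ == _).
    apply/setP=> z; rewrite !inE; have [->|] := eqVneq z (lab x) => //=.
    by rewrite (negbTE xa).
  move=> b; rewrite !inE => /andP[ba bx].
  by rewrite eq_sym (negbTE bx) (negbTE xa) mul0r.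
have [lA|lA] := boolP (lab x \in A); last first.
  rewrite (bigD1 (lab x)) /=; last by rewrite inE.
  rewrite finset.setU11 mul1r.
  rewrite [X in _ + X]big1 ?addr0; last first.
    move=> b; rewrite !inE => /andP[ba bx].
    by rewrite eq_sym (negbTE bx) (negbTE lA) mul0r.
  apply: eq_bigr => s sS /=; rewrite (negbTE lA) mul0r addr0.
  by rewrite finset.setU1K.
rewrite big_split /=.
transitivity (\sum_(s in S) \sum_(b in ~: A)
   rainbow_paths k.+1 (S :\ s) (b |: (A :\ lab x)) (grid_step s x)).
  rewrite exchange_big /=; apply: eq_bigr => b; rewrite inE => bA.
  rewrite finset.in_setU lA orbT mul1r; apply: eq_bigr => s sS.
  rewrite (_ : ((b |: A) :\ lab x = b |: (A :\ lab x))%SET) //.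
  apply/setP=> z; rewrite !inE; have [->|//] := eqVneq z (lab x).
  by rewrite /= orbF; apply/esym/negbTE; apply: contraNneq bA => <-.
transitivity (\sum_(s in S) (\sum_(b in ~: (A :\ lab x))
     rainbow_paths k.+1 (S :\ s) (b |: (A :\ lab x)) (grid_step s x)
     + rainbow_paths k.+1 (S :\ s) A (grid_step s x))).
  apply: eq_bigr => s sS; rewrite [in RHS](bigD1 (lab x)) ?inE ?eqxx //=.
  rewrite finset.setD1K // [X in _ = X + _]addrC -addrA addrr_F2 addr0.
  apply: eq_bigl => b; rewrite !inE; have [->|] //= := eqVneq b (lab x).
    by rewrite lA.
  by rewrite andbT.
rewrite big_split /= addrC; congr (_ + _).
transitivity (\sum_(s in S) \sum_(t in S :\ s)
    (rainbow_paths k (S :\ s :\ t) (A :\ lab x) (grid_step t (grid_step s x))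
     + rainbow_paths k (S :\ s :\ t) (A :\ lab x) (grid_step s x))).
  apply: eq_bigr => s sS; apply: IH.
    by move: Sk; rewrite (cardsD1 s) sS add1n => -[].
  by move: Ak; rewrite (cardsD1 (lab x)) lA add1n => -[].
under [LHS]eq_bigr => s sS do rewrite big_split /=.
have SC s t : (S :\ s :\ t = S :\ t :\ s)%SET.
  by apply/setP=> z; rewrite !inE; case: (z == s); case: (z == t).
rewrite big_split /= sum_offdiag_F2 ?add0r; last first.
  by move=> s t; rewrite grid_stepC SC.
under [RHS]eq_bigr do rewrite /= lA mul1r.
rewrite (exchange_big_dep (mem S)) /=; last by move=> s t _ /finset.setD1P[].
apply: eq_bigr => t tS; apply: eq_big => [s|s _].
  by rewrite !inE eq_sym tS andbT andbC.
by rewrite SC.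
Qed.

(** A nonzero parity yields an actual path. This locates labels in a unit cell, and in the
    contrapositive it kills the terms whose cell cannot show some label. *)
Lemma rainbow_paths_label k S A x a : #|S| = k -> #|A| = k.+1 ->
  rainbow_paths k S A x != 0 -> a \in A ->
  exists y : {ffun 'I_n -> nat},
    lab y = a /\ (forall i, x i <= y i <= x i + (i \in S))%N.
Proof.
elim: k S A x => [|k IH] S A x Sk Ak /=.
  have [->|_] := eqVneq A [set lab x]%SET; last by rewrite eqxx.
  rewrite inE => _ /eqP ->; exists x; split => // i; lia.
have [lA|] := boolP (lab x \in A); last by rewrite mul0r eqxx.
rewrite mul1r => nz aA.
have [xa|xa] := eqVneq (lab x) a; first by exists x; split => // i; lia.
have /existsP[s /andP[sS nzs]] : [exists s, (s \in S) &&
    (rainbow_paths k (S :\ s) (A :\ lab x) (grid_step s x) != 0)].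
  apply: contraNT nz => /existsPn H; apply/eqP; apply: big1 => s sS.
  by have := H s; rewrite sS => /negPn/eqP.
have [|||y [ya yx]] := IH _ _ _ _ _ nzs.
- by move: Sk; rewrite (cardsD1 s) sS add1n => -[].
- by move: Ak; rewrite (cardsD1 (lab x)) lA add1n => -[].
- by rewrite !inE eq_sym xa.
exists y; split=> // i; have := yx i; rewrite !ffunE !inE.
by have [->|] := eqVneq i s; rewrite ?sS /=; lia.
Qed.

End GridSperner.
Arguments rainbow_paths : simpl never.

(** * Sperner's lemma on a cubical grid *)

Section GridSpernerTheorem.
Variables (n N : nat) (N_gt0 : (0 < N)%N) (lab : {ffun 'I_n -> nat} -> 'I_n.+1).
Hypothesis lab_lo : forall (x : {ffun 'I_n -> nat}) (i : 'I_n),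
  x i = 0%N -> (lab x <= i)%N.
Hypothesis lab_hi : forall (x : {ffun 'I_n -> nat}) (i : 'I_n),
  x i = N -> lab x <> i :> nat.

Let point (z : {ffun 'I_n -> 'I_N.+1}) : {ffun 'I_n -> nat} :=
  [ffun i => z i : nat].

(** The lower corners of the unit cells in the face of dimension [k] where the coordinates from [k]
    on vanish. *)
Let in_box (k : nat) (z : {ffun 'I_n -> 'I_N.+1}) : bool :=
  [forall i : 'I_n, if (i < k)%N then (z i < N)%N else z i == 0%N :> nat].

Let dirs (k : nat) : {set 'I_n} := [set i : 'I_n | (i < k)%N]%SET.
Let labels (k : nat) : {set 'I_n.+1} := [set i : 'I_n.+1 | (i <= k)%N]%SET.

Let rainbow_count (k : nat) : 'F_2 :=
  \sum_(z | in_box k z) rainbow_paths lab k (dirs k) (labels k) (point z).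

Let card_dirs k : (k <= n)%N -> #|dirs k| = k.
Proof. by move=> kn; rewrite -sum1dep_card (big_ord_narrow kn) sum1_card card_ord. Qed.

Let card_labels k : (k <= n)%N -> #|labels k| = k.+1.
Proof. by move=> kn; rewrite -sum1dep_card (big_ord_narrow_leq kn) sum1_card card_ord. Qed.

(** Along [s], the upper end of a cell is the lower end of the next one. These inner terms cancel
    modulo 2, so only the sides [z s = N] and [z s = 0] remain. *)
Let sum_step (k : nat) (s : 'I_n) (g : {ffun 'I_n -> nat} -> 'F_2) : (s < k)%N ->
  \sum_(z | in_box k z) (g (grid_step s (point z)) + g (point z)) =
  \sum_(z : {ffun 'I_n -> 'I_N.+1} | [forall i : 'I_n, if i == s then z i == N :> nat else
              if (i < k)%N then (z i < N)%N else z i == 0%N :> nat]) g (point z)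
  + \sum_(z | in_box k z && (z s == 0%N :> nat)) g (point z).
Proof.
move=> sk; rewrite big_split /=.
pose up (z : {ffun 'I_n -> 'I_N.+1}) : {ffun 'I_n -> 'I_N.+1} :=
  [ffun i => if i == s then inord (z i).+1 else z i].
pose dn (z : {ffun 'I_n -> 'I_N.+1}) : {ffun 'I_n -> 'I_N.+1} :=
  [ffun i => if i == s then inord (z i).-1 else z i].
pose side (z : {ffun 'I_n -> 'I_N.+1}) := [forall i : 'I_n, if i == s then z i == N :> nat else
              if (i < k)%N then (z i < N)%N else z i == 0%N :> nat].
pose mid (z : {ffun 'I_n -> 'I_N.+1}) := [forall i : 'I_n, if i == s then (0 < z i)%N else
              if (i < k)%N then (z i < N)%N else z i == 0%N :> nat].
have boxs z : in_box k z -> (z s < N)%N by move/forallP/(_ s); rewrite sk.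
have -> : \sum_(z | in_box k z) g (grid_step s (point z)) =
          \sum_(z | mid z) g (point z).
  rewrite [RHS](reindex_onto up dn) /=.
    apply: eq_big => [z|z zB]; last first.
      congr g; apply/ffunP=> i; rewrite !ffunE; case: eqVneq => [->|_].
        by rewrite inordK ?addn1 // ltnS boxs.
      by rewrite addn0.
    apply/idP/andP=> [zB|[/forallP H /eqP zE]].
      split; last first.
        apply/eqP/ffunP=> i; rewrite !ffunE; case: eqVneq => [->|//].
        have zs : (inord (z s).+1 : 'I_N.+1) = (z s).+1 :> nat.
          by rewrite inordK // ltnS boxs.
        by rewrite zs inord_val.
      apply/forallP=> i; rewrite ffunE; case: eqVneq => [->|si].
        by rewrite inordK // ltnS boxs.
      by have /forallP/(_ i) := zB.
    apply/forallP=> i; have := H i; rewrite ffunE.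
    have [->|//] := eqVneq i s; rewrite sk.
    move/ffunP/(_ s): zE; rewrite !ffunE eqxx => /(congr1 val) /= zs.
    (* If [z s = N], then [inord N.+1] falls back to 0 and the round trip through [up] and [dn]
       gives [N = 0], against [N_gt0]. *)
    move=> H1; rewrite ltn_neqAle -ltnS ltn_ord andbT; apply/negP=> /eqP zN.
    move: zs; rewrite /inord !val_insubd zN !ltnS ltnn /= => zs.
    by move: (N_gt0); rewrite zs ltnn.
  move=> z /forallP H; apply/ffunP=> i; rewrite !ffunE; case: eqVneq => [->|//].
  have := H s; rewrite eqxx => z0.
  have zs : (inord (z s).-1 : 'I_N.+1) = (z s).-1 :> nat.
    by rewrite inordK // prednK // ltnW.
  by rewrite zs prednK // inord_val.
rewrite (bigID side) /= [X in _ + X = _](bigID (fun z : {ffun 'I_n -> 'I_N.+1} =>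
  z s == 0%N :> nat)) /=.
have -> : \sum_(z | mid z && side z) g (point z) = \sum_(z | side z) g (point z).
  apply: eq_bigl => z; apply: andb_idl => /forallP H; apply/forallP=> i.
  by have := H i; have [->|//] := eqVneq i s => /eqP ->.
have -> : \sum_(z | mid z && ~~ side z) g (point z) =
          \sum_(z | in_box k z && (z s != 0%N :> nat)) g (point z).
  apply: eq_bigl => z; apply/andP/andP => [[/forallP H /forallPn[j]]|[/forallP H z0]].
    have := H j; have [->|_ ->//] := eqVneq j s; rewrite -lt0n => zs zN.
    split=> //; apply/forallP=> i; have := H i; have [->|//] := eqVneq i s.
    by move=> _; rewrite sk ltn_neqAle -ltnS ltn_ord andbT zN.
  split.
    apply/forallP=> i; have := H i; have [->|//] := eqVneq i s.
    by rewrite lt0n => _.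
  apply/negP=> /forallP/(_ s); rewrite eqxx => /eqP zN.
  by have := H s; rewrite sk zN ltnn.
by rewrite addrACA addrr_F2 addr0.
Qed.

(** The boundary formula turns cells of dimension [k.+1] into their faces; inner faces cancel, and
    the labelling rules leave only the face where coordinate [k] is 0. *)
Let rainbow_countS (k : nat) (kn : (k < n)%N) :
  rainbow_count k.+1 = rainbow_count k.
Proof.
pose o : 'I_n := Ordinal kn.
have lk : #|labels k| = k.+1 by apply: card_labels; exact: ltnW.
have dk : #|dirs k.+1| = k.+1 by exact: card_dirs.
have dD s : s \in dirs k.+1 -> #|dirs k.+1 :\ s| = k.
  by move=> sd; move: dk; rewrite (cardsD1 s) sd add1n => -[].
pose P s x := rainbow_paths lab k (dirs k.+1 :\ s) (labels k) x.
transitivity (\sum_(s in dirs k.+1) \sum_(z | in_box k.+1 z)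
   (P s (grid_step s (point z)) + P s (point z))).
  rewrite exchange_big /=; apply: eq_bigr => z zB.
  rewrite -(rainbow_paths_boundary _ _ dk lk).
  (* Only the label [k.+1] can complete [labels k]: a larger one requires a coordinate [k.+1], which
     vanishes along the path, and then [lab_lo] bounds the labels by [k.+1]. *)
  rewrite (bigD1 (inord k.+1)) /=; last by rewrite !inE inordK ?ltnn.
  rewrite big1 ?addr0; last first.
    move=> b /andP[]; rewrite !inE -ltnNge => kb bk.
    apply/eqP; apply: contraT => nz.
    have [||y [yb yz]] := rainbow_paths_label _ _ nz (finset.setU11 b _).
    - exact: dk.
    - by rewrite cardsU1 !inE -ltnNge kb lk.
    have kb' : (k.+1 < b)%N.
      rewrite ltn_neqAle kb andbT; apply: contraNneq bk => kb'.
      by apply/eqP/val_inj; rewrite /= inordK -?kb'.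
    have kn' : (k.+1 < n)%N by have := ltn_ord b; lia.
    have := yz (Ordinal kn'); rewrite !inE /= ltnn addn0 ffunE.
    have /forallP/(_ (Ordinal kn')) := zB; rewrite /= ltnn => /eqP -> y0.
    have /lab_lo : y (Ordinal kn') = 0%N by lia.
    by rewrite yb leqNgt kb'.
  congr rainbow_paths; apply/setP=> i; rewrite !inE.
  by rewrite leq_eqVlt ltnS -val_eqE /= inordK.
transitivity (\sum_(s in dirs k.+1)
     \sum_(z | in_box k.+1 z && (z s == 0%N :> nat)) P s (point z)).
  apply: eq_bigr => s sd; rewrite sum_step; last by rewrite inE in sd.
  (* On the side [z s = N] the path never moves along [s], so [lab_hi] excludes the label [s], which
     belongs to [labels k]. *)
  rewrite [X in X + _]big1 ?add0r // => z /forallP/(_ s); rewrite eqxx => /eqP zN.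
  apply/eqP; apply: contraT => nz.
  rewrite inE in sd.
  have sl : (widen_ord (leqnSn n) s) \in labels k by rewrite inE.
  have [||y [yb yz]] := rainbow_paths_label _ _ nz sl => //.
    by rewrite dD // inE.
  have := yz s; rewrite !inE eqxx addn0 ffunE zN => ys.
  have /lab_hi : y s = N by lia.
  by rewrite yb.
rewrite (bigD1 o) /=; last by rewrite inE.
(* For [s < k], the side [z s = 0] bounds all labels by [s], so the label [k] is missing. *)
rewrite [X in _ + X]big1 ?addr0; last first.
  move=> s; rewrite inE => /andP[sk so]; apply: big1 => z /andP[_ /eqP z0].
  have sk' : (s < k)%N.
    by rewrite ltn_neqAle -ltnS sk andbT; apply: contra_neq so => sk'; exact: val_inj.
  apply/eqP; apply: contraT => nz.
  have kl : (inord k \in labels k) by rewrite inE inordK // ltnW.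
  have [||y [yb yz]] := rainbow_paths_label _ _ nz kl => //.
    by rewrite dD // inE.
  have := yz s; rewrite !inE eqxx addn0 ffunE z0 => ys.
  have /lab_lo : y s = 0%N by lia.
  by rewrite yb inordK; lia.
apply: eq_big => [z|z _].
  apply/andP/forallP => [[/forallP H zo] i|H].
    have := H i; have [->|io] := eqVneq i o; first by rewrite ltnn.
    have -> // : (i < k.+1)%N = (i < k)%N.
    by rewrite ltnS leq_eqVlt -val_eqE /= in io *; rewrite (negbTE io).
  split; last by have := H o; rewrite ltnn.
  apply/forallP=> i; have := H i.
  have [->|io] := eqVneq i o; first by rewrite ltnn ltnSn => /eqP ->.
  have -> // : (i < k.+1)%N = (i < k)%N.
  by rewrite ltnS leq_eqVlt -val_eqE /= in io *; rewrite (negbTE io).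
congr rainbow_paths; apply/setP=> i; rewrite !inE -val_eqE /= ltnS.
by rewrite [RHS]ltn_neqAle.
Qed.

(** The parity is the same for every [k]. At [k = 0] it is 1, since the only path is the origin with
    label 0; so some cell has a rainbow path at [k = n]. *)
Lemma grid_sperner : exists z : {ffun 'I_n -> nat}, (forall i, z i < N)%N /\
  forall a : 'I_n.+1, exists y : {ffun 'I_n -> nat},
    lab y = a /\ forall i, (z i <= y i <= (z i).+1)%N.
Proof.
have C0 : rainbow_count 0 = 1.
  rewrite /rainbow_count (bigD1 [ffun=> ord0]) /=; last first.
    by apply/forallP=> i; rewrite ffunE.
  rewrite big1 ?addr0 => [|z /andP[/forallP zB /eqP[]]]; last first.
    by apply/ffunP=> i; rewrite ffunE; apply: val_inj; have /eqP := zB i.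
  rewrite /rainbow_paths (_ : (_ == _) = true) //; apply/eqP/setP=> i; rewrite !inE leqn0 -val_eqE /=.
  suff -> : lab (point [ffun=> ord0]) = 0%N :> nat by [].
  (* For [n = 0] there is no coordinate to feed to [lab_lo], but 0 is the only label. *)
  case: (posnP n) => [n0|n0].
    by have := ltn_ord (lab (point [ffun=> ord0])); rewrite [X in (_ < X.+1)%N]n0; case: (nat_of_ord _).
  apply/eqP; rewrite -leqn0.
  by apply: (@lab_lo _ (Ordinal n0)); rewrite !ffunE.
have Ck k : (k <= n)%N -> rainbow_count k = 1.
  by elim: k => // k IH kn; rewrite rainbow_countS // IH // ltnW.
have /existsP[z /andP[zB nz]] : [exists z, in_box n z &&
    (rainbow_paths lab n (dirs n) (labels n) (point z) != 0)].
  apply: contraT => /existsPn H; have := Ck n (leqnn n).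
  rewrite /rainbow_count big1 // => z zB.
  by have := H z; rewrite zB => /negPn/eqP.
exists (point z); split=> [i|a].
  by have /forallP/(_ i) := zB; rewrite ltn_ord ffunE.
have al : a \in labels n by rewrite inE -ltnS.
have [||y [ya yz]] := rainbow_paths_label _ _ nz al; [exact: card_dirs|exact: card_labels|].
by exists y; split=> // i; have := yz i; rewrite !inE ltn_ord addn1.
Qed.
End GridSpernerTheorem.

(** * Sperner's lemma on the cube, by compactness *)

Lemma rV_near (R : realType) (n : nat) (x : 'rV[R]_n) (e : R) : 0 < e ->
  nbhs x [set y : 'rV[R]_n | forall i, `|x ord0 i - y ord0 i| < e].
Proof.
move=> e0; have : nbhs x (ball x e) by apply: nbhsx_ballx.
by apply: filterS => y [_ xy] i; exact: xy.
Qed.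

(** Grids of mesh 2 / (N + 1) provide rainbow cells; a cluster point of their lower corners is
    approached by all labels at once. *)
Lemma cube_sperner (R : realType) (n : nat) (lab : 'rV[R]_n -> 'I_n.+1) :
  (forall x : 'rV[R]_n, (forall i, `|x ord0 i| <= 1) -> forall i,
     x ord0 i = -1 -> (lab x <= i)%N) ->
  (forall x : 'rV[R]_n, (forall i, `|x ord0 i| <= 1) -> forall i,
     x ord0 i = 1 -> lab x <> i :> nat) ->
  exists x : 'rV[R]_n, forall U, nbhs x U ->
    forall a, exists2 y, U y & lab y = a.
Proof.
move=> lo hi.
(* The grid labelling is defined on all of [nat], while [lab] is constrained only on the cube;
   [minn] keeps every grid point inside. *)
pose c (N k : nat) : R := -1 + 2 * ((minn k N)%:R / N%:R).
pose pt N (z : {ffun 'I_n -> nat}) : 'rV[R]_n := \row_i c N (z i).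
have c_cube N k : `|c N.+1 k| <= 1.
  have : 0 <= (minn k N.+1)%:R / N.+1%:R :> R by rewrite divr_ge0.
  have : (minn k N.+1)%:R / N.+1%:R <= 1 :> R.
    by rewrite ler_pdivrMr ?ltr0n // mul1r ler_nat geq_minr.
  rewrite ler_norml /c; move: (_ / _) => t t1 t0.
  by apply/andP; split; lra.
have pt_cube N z i : `|pt N.+1 z ord0 i| <= 1 by rewrite mxE.
have grid N : exists z : {ffun 'I_n -> nat}, (forall i, z i < N.+1)%N /\
    forall a, exists y : {ffun 'I_n -> nat},
      lab (pt N.+1 y) = a /\ forall i, (z i <= y i <= (z i).+1)%N.
  apply: (grid_sperner (ltn0Sn N)) => z i zi.
    by apply: lo => //; rewrite mxE zi /c min0n mul0r mulr0 addr0.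
  by apply: hi => //; rewrite mxE zi /c minnn divff ?pnatr_eq0 // mulr1; ring.
have [z zP] := choice grid.
pose s N := pt N.+1 (z N).
pose cube : set 'rV[R]_n := [set v | forall i, `[-1, 1]%classic (v ord0 i)].
have cubeK : compact cube.
  have := @rV_compact R n (fun=> `[-1, 1]%classic).
  by apply => _; exact: segment_compact.
have scube N : cube (s N).
  by move=> i /=; rewrite in_itv /= -ler_norml pt_cube.
have [|x [_ xcl]] := cubeK (s @ \oo) _.
  by exists 0%N => // N _; exact: scube.
exists x => U /nbhs_ballP[e /= e0 xU] a.
have [N0 N0e] : exists N0 : nat, forall N, (N0 <= N)%N -> 2 / N.+1%:R < e / 2.
  have e40 : 0 < e / 4 by rewrite divr_gt0.
  have [N0 _ H] := near_infty_natSinv_lt (PosNum e40).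
  exists N0 => N N0N; have : N.+1%:R^-1 < e / 4 := H _ N0N.
  by move: (N.+1%:R^-1) => t; lra.
have sN0 : (s @ \oo) [set s N | N in [set N | (N0 <= N)%N]].
  by exists N0 => // N N0N; exists N.
have e20 : 0 < e / 2 by rewrite divr_gt0.
have [_ [[N /= N0N <-] xs]] := xcl _ _ sN0 (rV_near x e20).
have [y [ya yz]] := (zP N).2 a.
exists (pt N.+1 y) => //; apply: xU; split=> // i j; rewrite (ord1 i) /=.
rewrite /ball /= (le_lt_trans (ler_distD (s N ord0 j) _ _)) //.
rewrite [ltRHS](splitr e) ltrD //.
rewrite !mxE /c; apply: le_lt_trans (N0e N N0N).
have /andP[zy yz1] := yz j; have zN := (zP N).1 j.
rewrite (minn_idPl (ltnW zN)).
have -> : minn (y j) N.+1 = y j by apply/minn_idPl; lia.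
rewrite opprD addrACA subrr add0r -mulrBr -mulrBl normrM ger0_norm // ler_wpM2l //.
rewrite normrM normfV [X in _ / X]ger0_norm // -[leRHS]mul1r ler_wpM2r ?invr_ge0 //.
have [->|->] : y j = z N j \/ y j = (z N j).+1 by lia.
  by rewrite subrr normr0.
by rewrite -natr1 opprD addrA subrr add0r normrN normr1.
Qed.

(** * Bricks of small size and low multiplicity *)

Section BrickPartition.
Variables (R : realType) (M : R).

(* Shifting row j by an amount that depends injectively on the indices chosen in
   the earlier rows makes the bricks of the j-th level meet in general position. *)
Definition brick_shift (p : seq int) : R := (pickle p).+2%:R^-1.

(** The head is the index of the latest level, and the tail determines its shift. Bricks have side 1
    / M. *)
Fixpoint brick (x : nat -> R) (j : nat) : seq int :=
  if j is j'.+1 then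
    Num.floor (M * x j' + brick_shift (brick x j')) :: brick x j'
  else [::].

Lemma brick_dist (x y : nat -> R) (j i : nat) : 0 < M -> (i < j)%N ->
  brick x j = brick y j -> M * `|x i - y i| < 1.
Proof.
move=> M0; elim: j => // j IH; rewrite ltnS leq_eqVlt => /orP[/eqP ->|ij] /= [].
  move=> + e; rewrite e; set s := brick_shift _ => fxy.
  rewrite -[M]gtr0_norm // -normrM mulrBr ltr_norml.
  have := Num.Theory.floor_itv (M * x j + s).
  have := Num.Theory.floor_itv (M * y j + s).
  by rewrite fxy !intrD => /andP[? ?] /andP[? ?]; apply/andP; split; lra.
by move=> _; exact: IH.
Qed.

(** The offset by 2 keeps shifts in an interval of length below 1, so shifts that differ by an
    integer are equal. *)
Lemma brick_shift_itv p : 0 < brick_shift p <= 1 / 2.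
Proof.
rewrite /brick_shift invr_gt0 ltr0n /= div1r lef_pV2 ?posrE ?ltr0n //.
by rewrite ler_nat.
Qed.

Lemma brick_shift_inj : injective brick_shift.
Proof.
move=> p q /invr_inj/eqP; rewrite eqr_nat => /eqP[].
exact: (pcan_inj pickleK).
Qed.

(** The floor is locally constant off the integers, and near an integer it can only drop by one. *)
Lemma near_floor (T : topologicalType) (g : T -> R) (t : T) :
  {for t, continuous g} ->
  \forall u \near t, Num.floor (g u) = Num.floor (g t) \/
    g t \is a Num.int /\ Num.floor (g u) = Num.floor (g t) - 1.
Proof.
move=> gc.
have /andP[f1 f2] := Num.Theory.floor_itv (g t).
have hi : \forall u \near t, g u < (Num.floor (g t) + 1)%:~R.
  exact: (cvgr_lt (g t)).
have lo : \forall u \near t, (Num.floor (g t) - 1)%:~R < g u.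
  apply: (cvgr_gt (g t)) => //.
  by apply: lt_le_trans f1; rewrite ltr_int gtrBl.
have [gi|gi] := boolP (g t \is a Num.int).
  near=> u.
  have u1 : g u < (Num.floor (g t) + 1)%:~R by near: u.
  have u2 : (Num.floor (g t) - 1)%:~R < g u by near: u.
  have := Num.Theory.floor_itv (g u) => /andP[u3 u4].
  have := le_lt_trans u3 u1; have := lt_trans u2 u4; rewrite !ltr_int => a b.
  have key (p q : int) : p < q + 1 -> q - 1 < p + 1 -> p = q \/ p = q - 1 by lia.
  by have [|] := key _ _ b a; [left|right].
have lt1 : (Num.floor (g t))%:~R < g t.
  rewrite lt_neqAle f1 andbT; apply: contra gi => /eqP <-; exact: intr_int.
have lo' : \forall u \near t, (Num.floor (g t))%:~R < g u.
  exact: (cvgr_gt (g t)).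
near=> u; left.
have u1 : g u < (Num.floor (g t) + 1)%:~R by near: u.
have u2 : (Num.floor (g t))%:~R < g u by near: u.
by apply/Num.Theory.floor_def; rewrite ltW.
Unshelve. all: by end_near.
Qed.

(* Near a given point only one brick of each level can split in two. *)
Lemma brick_order (T : topologicalType) (x : T -> nat -> R) (t : T) (j : nat) :
  (forall i, (i < j)%N -> {for t, continuous (fun u => x u i)}) ->
  exists2 B : seq (seq int), (size B <= j.+1)%N &
    \forall u \near t, brick (x u) j \in B.
Proof.
elim: j => [|j IH] xc; first by exists [:: [::]] => //; near=> u; rewrite inE.
have [i ij|B Bj Bt] := IH _; first by apply: xc; rewrite ltnS ltnW.
pose g p u : R := M * x u j + brick_shift p.
have gc p : {for t, continuous (g p)}.
  by apply: cvgD; [apply: cvgM; [exact: cvg_cst|exact: xc]|exact: cvg_cst].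
pose B' := undup B.
pose k p := Num.floor (g p t).
exists ([seq k p :: p | p <- B'] ++
        [seq (k p - 1) :: p | p <- B' & g p t \is a Num.int]).
  rewrite size_cat !size_map -(addn1 j.+1) leq_add //.
    exact: leq_trans (size_undup _) Bj.
  (* At most one prefix has [g p t] integral: for two of them the shifts would differ by an integer,
     hence coincide. So the list grows by at most one. *)
  have : uniq [seq p <- B' | g p t \is a Num.int].
    by rewrite filter_uniq ?undup_uniq.
  have : all (fun p => g p t \is a Num.int) [seq p <- B' | g p t \is a Num.int].
    exact: filter_all.
  case: [seq p <- B' | g p t \is a Num.int] => [|p [|q s]] //.
  move=> /and3P[gip giq _] /andP[].
  rewrite inE negb_or => /andP[/negP pq _] _; case: pq; apply/eqP.
  apply: brick_shift_inj; apply/eqP; rewrite -subr_eq0.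
  have : brick_shift p - brick_shift q \is a Num.int.
    have -> : brick_shift p - brick_shift q = g p t - g q t.
      by rewrite /g opprD addrACA subrr add0r.
    by rewrite rpredB.
  move=> /intrP[z ez]; rewrite ez; apply/eqP.
  have /andP[p0 p1] := brick_shift_itv p; have /andP[q0 q1] := brick_shift_itv q.
  have : (-1)%:~R < z%:~R :> R by rewrite -ez; lra.
  have : z%:~R < 1%:~R :> R by rewrite -ez; lra.
  by rewrite !ltr_int => ? ?; have -> : z = 0 by lia.
have near_k : \forall u \near t, forall p, p \in B' ->
    Num.floor (g p u) = k p \/ g p t \is a Num.int /\ Num.floor (g p u) = k p - 1.
  elim: (B') => [|p s IHs]; first by near=> u.
  near=> u => q; rewrite inE => /orP[/eqP ->|].
    by near: u; exact: near_floor.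
  by move: q; near: u.
near=> u.
have uB : brick (x u) j \in B' by rewrite mem_undup; near: u.
have : Num.floor (g (brick (x u) j) u) = k (brick (x u) j) \/
    g (brick (x u) j) t \is a Num.int /\
    Num.floor (g (brick (x u) j) u) = k (brick (x u) j) - 1.
  by move: (brick (x u) j) uB; near: u.
rewrite mem_cat /= -/(g _ u); case=> [->|[gi ->]]; apply/orP.
  by left; apply/mapP; exists (brick (x u) j).
by right; apply/mapP; exists (brick (x u) j); rewrite // mem_filter gi.
Unshelve. all: by end_near.
Qed.

End BrickPartition.

(** * Convergence in subspaces and products *)

Lemma cvg_to_within {U : Type} {T : topologicalType} (F : set_system U)
    {FF : Filter F} (f : U -> T) (A : set T) (a : T) :
  f @ F --> a -> (forall u, A (f u)) -> f @ F --> within A (nbhs a).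
Proof.
move=> fa fA W /(fa _) FW.
by apply: (@filterS _ F _ (f @^-1` [set x | A x -> W x])) => // u /(_ (fA u)).
Qed.

Lemma cvg_to_pair {U : Type} {X Y : topologicalType} (F : set_system U)
    {FF : Filter F} (f : U -> X) (g : U -> Y) (a : X) (b : Y) :
  f @ F --> a -> g @ F --> b -> (f u, g u) @[u --> F] --> (a, b).
Proof. exact: cvg_pair. Qed.

Lemma cvg_set_type {U : Type} {T : topologicalType} (A : set T) (F : set_system U)
    {FF : Filter F} (f : U -> A) (a : A) :
  set_val (f u) @[u --> F] --> set_val a -> f @ F --> a.
Proof.
move=> fa W [_ [[B Bop <-] Ba BW]].
have /fa FB : nbhs (set_val a) B by apply: open_nbhs_nbhs.
by apply: (@filterS _ F _ ((set_val \o f) @^-1` B)) => // u; exact: BW.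
Qed.

Lemma set_val_continuous (T : topologicalType) (A : set T) :
  continuous (fun x : A => set_val x).
Proof. exact: initial_continuous. Qed.

(** Pasting: each branch either has the right limit or is eventually not taken. *)
Lemma cvg_if_then_else {U : Type} {T : topologicalType} (F : set_system U)
    {FF : Filter F} (p : pred U) (u v : U -> T) (a : T) :
  u @ F --> a \/ (\forall x \near F, ~~ p x) ->
  v @ F --> a \/ (\forall x \near F, p x) ->
  (if p x then u x else v x) @[x --> F] --> a.
Proof.
move=> ua va W Wa.
have {}ua : \forall x \near F, p x -> W (u x).
  case: ua => [/(_ _ Wa) FW|].
    by apply: (@filterS _ F _ (u @^-1` W)) => // x Wx _.
  by apply: filterS => x /negP.
have {}va : \forall x \near F, ~~ p x -> W (v x).
  case: va => [/(_ _ Wa) FW|].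
    by apply: (@filterS _ F _ (v @^-1` W)) => // x Wx _.
  by apply: filterS => x ->.
suff : \forall x \near F, W (if p x then u x else v x) by [].
apply: filterS2 ua va => x.
by case: (p x) => [h _|_ h]; exact: h.
Qed.

(** * Clamping to the unit interval *)

Section UnitInterval.
Variable R : realType.

(** This is min(max(t, 0), 1), written with absolute values so that continuity follows from that of
    the norm. *)
Definition clamp01 (t : R) : R := (`|t| - `|t - 1| + 1) / 2.

Lemma clamp01_continuous : continuous clamp01.
Proof.
move=> t; apply: cvgM; last exact: cvg_cst.
apply: cvgD; last exact: cvg_cst.
apply: cvgB; first exact: norm_continuous.
by apply: cvg_norm; apply: cvgB; [exact: cvg_id|exact: cvg_cst].
Qed.

Lemma clamp01_itv t : 0 <= clamp01 t <= 1.
Proof.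
rewrite /clamp01; case: (ger0P t) => t0; case: (ger0P (t - 1)) => t1;
by apply/andP; split; lra.
Qed.

Lemma clamp01_le0 t : t <= 0 -> clamp01 t = 0.
Proof. by move=> t0; rewrite /clamp01 !ler0_norm; lra. Qed.

Lemma clamp01_ge1 t : 1 <= t -> clamp01 t = 1.
Proof. by move=> t1; rewrite /clamp01 !ger0_norm; lra. Qed.

End UnitInterval.

(** * Calculus of homotopies *)

Section Homotopy.
Variable R : realType.
Implicit Types X Y Z : topologicalType.

(** Clamping the time extends a homotopy to all of [R], which replaces continuity within a subset by
    plain continuity. *)
Lemma homotopic_continuous X Y (f g : X -> Y) : homotopic R f g ->
  exists h : R * X -> Y, [/\ continuous h,
    forall t x, t <= 0 -> h (t, x) = f x & forall t x, 1 <= t -> h (t, x) = g x].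
Proof.
move=> [h [hc h0 h1]]; exists (fun p => h (clamp01 p.1, p.2)); split.
- move=> [t x].
  have D p : (`[0, 1]%classic `*` [set: X]) (clamp01 p, x).
    by split=> //=; rewrite in_itv /= clamp01_itv.
  have /subspace_continuousP/(_ _ (D _ t)) := hc.
  apply: (cvg_comp (fun p : R * X => (clamp01 p.1, p.2))).
  apply: cvg_to_within => [|[t' x'] /=].
    apply: cvg_to_pair => /=; last exact: cvg_snd.
    apply: (@cvg_comp _ _ _ (fun p : R * X => p.1) (@clamp01 R) (nbhs (t, x)) (nbhs t)).
      exact: cvg_fst.
    exact: clamp01_continuous.
  by split=> //=; rewrite in_itv /= clamp01_itv.
- by move=> t x t0 /=; rewrite clamp01_le0.
- by move=> t x t1 /=; rewrite clamp01_ge1.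
Qed.

Lemma continuous_homotopic X Y (f g : X -> Y) (h : R * X -> Y) :
  continuous h -> (forall x, h (0, x) = f x) -> (forall x, h (1, x) = g x) ->
  homotopic R f g.
Proof. by move=> hc h0 h1; exists h; split=> //; exact: continuous_subspaceT. Qed.

Lemma homotopic_trans X Y (f g k : X -> Y) :
  homotopic R f g -> homotopic R g k -> homotopic R f k.
Proof.
move=> /homotopic_continuous[h [hc h0 h1]] /homotopic_continuous[h' [h'c h'0 h'1]].
apply: (@continuous_homotopic _ _ _ _
  (fun p => if p.1 <= 1 / 2 then h (2 * p.1, p.2) else h' (2 * p.1 - 1, p.2))).
- move=> [t x].
  have cf : {for (t, x), continuous (fun p : R * X => h (2 * p.1, p.2))}.
    apply: (@continuous_comp _ _ _ (fun p : R * X => (2 * p.1, p.2)) h); last exact: hc.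
    apply: cvg_to_pair => /=; last exact: cvg_snd.
    by apply: cvgM; [exact: cvg_cst|exact: cvg_fst].
  have cg : {for (t, x), continuous (fun p : R * X => h' (2 * p.1 - 1, p.2))}.
    apply: (@continuous_comp _ _ _ (fun p : R * X => (2 * p.1 - 1, p.2)) h'); last exact: h'c.
    apply: cvg_to_pair => /=; last exact: cvg_snd.
    apply: cvgB; last exact: cvg_cst.
    by apply: cvgM; [exact: cvg_cst|exact: cvg_fst].
  have fstc : {for (t, x), continuous (fun p : R * X => p.1)} by exact: cvg_fst.
  apply: (@cvg_if_then_else _ _ (nbhs (t, x)) _ (fun p : R * X => p.1 <= 1 / 2)
    (fun p => h (2 * p.1, p.2)) (fun p => h' (2 * p.1 - 1, p.2))) => /=.
    have [t2|t2] := leP t (1 / 2); [by left|right].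
    apply: (@filterS _ (nbhs (t, x)) _ _ _ _ (cvgr_gt _ fstc _ t2)) => -[t' x'] /=.
    by rewrite -ltNge.
  have [t2|t2|te] := ltgtP t (1 / 2).
  + right; apply: (@filterS _ (nbhs (t, x)) _ _ _ _ (cvgr_lt _ fstc _ t2)) => -[t' x'] /=.
    exact: ltW.
  + by left.
  (* At time 1/2 the first homotopy has ended and the second begins, both at [g x]. *)
  + left; rewrite h1; last lra.
    by rewrite -(h'0 (2 * t - 1)) //; lra.
- by move=> x /=; rewrite ifT ?h0 //; lra.
- by move=> x /=; rewrite ifF ?h'1 //; lra.
Qed.

Lemma homotopic_compl X Y Z (f g : X -> Y) (k : Y -> Z) : continuous k ->
  homotopic R f g -> homotopic R (k \o f) (k \o g).
Proof.
move=> kc /homotopic_continuous[h [hc h0 h1]].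
apply: (@continuous_homotopic _ _ _ _ (k \o h)) => [p|x|x] /=.
- by apply: continuous_comp; [exact: hc|exact: kc].
- by rewrite h0.
- by rewrite h1.
Qed.

Lemma homotopic_compr X Y Z (f g : Y -> Z) (k : X -> Y) : continuous k ->
  homotopic R f g -> homotopic R (f \o k) (g \o k).
Proof.
move=> kc /homotopic_continuous[h [hc h0 h1]].
apply: (@continuous_homotopic _ _ _ _ (fun p => h (p.1, k p.2))) => [[t x]|x|x] /=.
- apply: (@continuous_comp _ _ _ (fun p : R * X => (p.1, k p.2)) h); last exact: hc.
  apply: cvg_to_pair => /=; first exact: cvg_fst.
  apply: (@cvg_comp _ _ _ (fun p : R * X => p.2) k (nbhs (t, x)) (nbhs x)).
    exact: cvg_snd.
  exact: kc.
- by rewrite h0.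
- by rewrite h1.
Qed.

Lemma homotopy_equivalent_sym X Y :
  homotopy_equivalent R X Y -> homotopy_equivalent R Y X.
Proof. by move=> [f [g [? ? ? ?]]]; exists g, f. Qed.

Lemma homotopy_equivalent_trans X Y Z : homotopy_equivalent R X Y ->
  homotopy_equivalent R Y Z -> homotopy_equivalent R X Z.
Proof.
move=> [f [g [fc gc gf fg]]] [f' [g' [f'c g'c g'f' f'g']]].
exists (f' \o f), (g \o g'); split.
- by move=> x; apply: continuous_comp; [exact: fc|exact: f'c].
- by move=> x; apply: continuous_comp; [exact: g'c|exact: gc].
- apply: homotopic_trans gf.
  exact: (homotopic_compl gc (homotopic_compr fc g'f')).
- apply: homotopic_trans f'g'.
  exact: (homotopic_compl f'c (homotopic_compr g'c fg)).
Qed.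

End Homotopy.

(** * Euclidean norm, radial projection and compactness of spheres *)

Section Sphere.
Variable R : realType.

Definition enorm (n : nat) (x : 'rV[R]_n) : R :=
  Num.sqrt (\sum_(i < n) x ord0 i ^+ 2).

Lemma sum_sqr_ge0 (n : nat) (x : 'rV[R]_n) : 0 <= \sum_(i < n) x ord0 i ^+ 2.
Proof. by apply: sumr_ge0 => i _; exact: sqr_ge0. Qed.

Lemma enorm_ge0 (n : nat) (x : 'rV[R]_n) : 0 <= enorm x.
Proof. exact: sqrtr_ge0. Qed.

Lemma sqr_enorm (n : nat) (x : 'rV[R]_n) :
  enorm x ^+ 2 = \sum_(i < n) x ord0 i ^+ 2.
Proof. by rewrite sqr_sqrtr // sum_sqr_ge0. Qed.

Lemma coord_le_enorm (n : nat) (x : 'rV[R]_n) (i : 'I_n) : `|x ord0 i| <= enorm x.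
Proof.
rewrite -ler_sqr ?nnegrE ?enorm_ge0 // sqr_enorm real_normK ?num_real //.
by rewrite (bigD1 i) //= lerDl; apply: sumr_ge0 => j _; exact: sqr_ge0.
Qed.

Lemma unit_sphereP (n : nat) (x : 'rV[R]_n) : unit_sphere R n x <-> enorm x = 1.
Proof.
rewrite /unit_sphere /=; split=> [xs|x1]; first by rewrite /enorm xs sqrtr1.
by rewrite -sqr_enorm x1 expr1n.
Qed.

Lemma enorm_sphere (n : nat) (x : unit_sphere R n) : enorm (set_val x) = 1.
Proof. by apply/unit_sphereP; exact: set_valP. Qed.

Lemma enormZ (n : nat) (a : R) (x : 'rV[R]_n) : enorm (a *: x) = `|a| * enorm x.
Proof.
rewrite /enorm -sqrtr_sqr -sqrtrM ?sqr_ge0 //; congr Num.sqrt.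
by rewrite mulr_sumr; apply: eq_bigr => i _; rewrite mxE exprMn.
Qed.

Lemma coord_cont (n : nat) (i : 'I_n) : continuous (fun x : 'rV[R]_n => x ord0 i).
Proof. exact: coord_continuous. Qed.

Lemma cvg_rV (U : Type) (F : set_system U) {FF : Filter F} (n : nat)
    (f : U -> 'rV[R]_n) (a : 'rV[R]_n) :
  (forall i, f u ord0 i @[u --> F] --> a ord0 i) -> f @ F --> a.
Proof.
move=> fa W /nbhs_ballP[e /= e0 aW].
have near_a : \forall u \near F, forall i, `|a ord0 i - f u ord0 i| < e.
  apply: filter_forall => i.
  by have /cvgrPdist_lt/(_ e e0) := fa i.
suff : \forall u \near F, W (f u) by []; move: near_a.
apply: filterS => u H; apply: aW; split=> // j i; rewrite (ord1 j); exact: H.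
Qed.

Lemma cvg_sumr (U : Type) (F : set_system U) {FF : Filter F} (I : Type)
    (r : seq I) (P : pred I) (f : I -> U -> R) (a : I -> R) :
  (forall i, P i -> f i @ F --> a i) ->
  \sum_(i <- r | P i) f i u @[u --> F] --> \sum_(i <- r | P i) a i.
Proof.
move=> fa; elim: r => [|i r IH].
  by under eq_fun do rewrite big_nil; rewrite big_nil; exact: cvg_cst.
under eq_fun do rewrite big_cons; rewrite big_cons; case: (boolP (P i)) => // Pi.
by apply: cvgD => //; exact: fa.
Qed.

Lemma enorm_continuous (n : nat) : continuous (@enorm n).
Proof.
move=> x; apply: (@continuous_comp _ _ _
  (fun x : 'rV[R]_n => \sum_(i < n) x ord0 i ^+ 2)); last exact: sqrt_continuous.
apply: (@cvg_sumr _ (nbhs x)) => i _.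
by apply: cvgM; exact: coord_cont.
Qed.

Definition sphere_default (n : nat) : 'rV[R]_n.+1 := delta_mx ord0 ord0.

Lemma sphere_defaultP n : sphere_default n \in unit_sphere R n.+1.
Proof.
apply/mem_set; rewrite /unit_sphere /= big_ord_recl mxE eqxx expr1n big1 ?addr0 //.
by move=> i _; rewrite mxE expr0n.
Qed.

(* At the origin the value is the junk point [sphere_default]. *)
Definition radial (n : nat) (x : 'rV[R]_n.+1) : unit_sphere R n.+1 :=
  insubd (exist (fun y => y \in unit_sphere R n.+1) _ (sphere_defaultP n)) ((enorm x)^-1 *: x).

Lemma set_val_radial (n : nat) (x : 'rV[R]_n.+1) : 0 < enorm x ->
  set_val (radial x) = (enorm x)^-1 *: x.
Proof.
move=> x0; rewrite set_valE /radial /= val_insubd ifT //; apply/mem_set/unit_sphereP.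
by rewrite enormZ gtr0_norm ?invr_gt0 // mulVf // gt_eqF.
Qed.

Lemma radial_continuous (n : nat) (x : 'rV[R]_n.+1) : 0 < enorm x ->
  {for x, continuous (@radial n)}.
Proof.
move=> x0; apply: (@cvg_set_type _ _ _ (nbhs x)); rewrite set_val_radial //.
have near0 : \forall y \near x, 0 < enorm y.
  exact: (@cvgr_gt _ _ (nbhs x) _ _ _ (@enorm_continuous n.+1 x) _ x0).
apply: (@cvg_trans _ ((enorm y)^-1 *: y @[y --> x])).
  apply: near_eq_cvg; apply: filterS near0 => y y0.
  by rewrite set_val_radial.
apply: (@cvg_rV _ (nbhs x)) => i.
under eq_fun do rewrite mxE; rewrite mxE; apply: cvgM; last exact: coord_cont.
by apply: cvgV; [rewrite gt_eqF|exact: enorm_continuous].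
Qed.

Lemma sphere_near (n : nat) (a : unit_sphere R n) (W : set (unit_sphere R n)) :
  nbhs a W -> exists2 e : R, 0 < e & forall b : unit_sphere R n,
    (forall i, `|set_val a ord0 i - set_val b ord0 i| < e) -> W b.
Proof.
move=> [_ [[B Bop <-] Ba BW]].
have /nbhs_ballP[e /= e0 aB] : nbhs (set_val a) B by apply: open_nbhs_nbhs.
exists e => // b ab; apply: BW; apply: aB; split=> // j i.
by rewrite (ord1 j); exact: ab.
Qed.

Lemma sphere_compact n : compact (unit_sphere R n).
Proof.
apply: (@subclosed_compact _ _ [set v : 'rV[R]_n | forall i, `[-1, 1]%classic (v ord0 i)]).
- have -> : unit_sphere R n = @enorm n @^-1` [set 1].
    by apply/seteqP; split=> x /unit_sphereP.
  apply: closed_comp => [x _|]; [exact: enorm_continuous|exact: closed_eq].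
- have := @rV_compact R n (fun=> `[-1, 1]%classic).
  by apply => _; exact: segment_compact.
- move=> x /unit_sphereP x1 i /=; rewrite in_itv /= -ler_norml -x1.
  exact: coord_le_enorm.
Qed.

(** Otherwise pairs at distance below 1 / (N + 1) have images at least [eta] apart in some
    coordinate; continuity of [g] at a cluster point of the first members contradicts this. *)
Lemma sphere_unif_continuous (m n : nat) (g : unit_sphere R m -> unit_sphere R n)
    (eta : R) : continuous g -> 0 < eta ->
  exists2 e : R, 0 < e & forall u v : unit_sphere R m,
    (forall i, `|set_val u ord0 i - set_val v ord0 i| < e) ->
    forall i, `|set_val (g u) ord0 i - set_val (g v) ord0 i| < eta.
Proof.
move=> gc eta0; apply: contrapT => H.
have {H} bad (N : nat) : exists uv : unit_sphere R m * unit_sphere R m,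
    (forall i, `|set_val uv.1 ord0 i - set_val uv.2 ord0 i| < N.+1%:R^-1) /\
    ~ forall i, `|set_val (g uv.1) ord0 i - set_val (g uv.2) ord0 i| < eta.
  apply: contrapT => H1; apply: H; exists N.+1%:R^-1 => // u v uv.
  by apply: contrapT => H2; apply: H1; exists (u, v).
have [s sP] := choice bad.
have [|x [xS xcl]] := @sphere_compact m (set_val (s N).1 @[N --> \oo]) _.
  by exists 0%N => // N _; exact: set_valP.
pose a : unit_sphere R m := exist (fun y => y \in unit_sphere R m) x (mem_set xS).
have eta2 : 0 < eta / 2 by rewrite divr_gt0.
have [e e0 ga] : exists2 e : R, 0 < e & forall b : unit_sphere R m,
    (forall i, `|set_val a ord0 i - set_val b ord0 i| < e) ->
    (forall i, `|set_val (g a) ord0 i - set_val (g b) ord0 i| < eta / 2).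
  apply: (@sphere_near m a [set b : unit_sphere R m |
    forall i, `|set_val (g a) ord0 i - set_val (g b) ord0 i| < eta / 2]).
  have := gc a; move/(_ [set c : unit_sphere R n | forall i,
    `|set_val (g a) ord0 i - set_val c ord0 i| < eta / 2]); apply.
  have := @set_val_continuous _ (unit_sphere R n) (g a).
  by move/(_ _ (rV_near (set_val (g a)) eta2)).
have e20 : 0 < e / 2 by rewrite divr_gt0.
have [N0 _ N0e] := near_infty_natSinv_lt (PosNum e20).
have sN0 : (set_val (s N).1 @[N --> \oo])
    [set set_val (s N).1 | N in [set N | (N0 <= N)%N]].
  by exists N0 => // N N0N; exists N.
have [_ [[N /= N0N <-] xs]] := xcl _ _ sN0 (rV_near x e20).
have [st] := sP N; apply => i.
apply: le_lt_trans (ler_distD (set_val (g a) ord0 i) _ _) _.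
rewrite [ltRHS]splitr ltrD //.
  rewrite distrC; apply: ga => j; apply: lt_trans (xs j) _; lra.
apply: ga => j; apply: le_lt_trans (ler_distD (set_val (s N).1 ord0 j) _ _) _.
rewrite [ltRHS]splitr ltrD //.
exact: lt_trans (st j) (N0e _ N0N).
Qed.

End Sphere.

(** * Invariance of dimension for spheres *)

Section SphereDimension.
Variable R : realType.

(** The label is [n] when no coordinate is negative, as [find] then returns the length of the
    list. *)
Lemma first_negative (n : nat) : exists L : 'rV[R]_n -> 'I_n.+1,
  (forall (y : 'rV[R]_n) (i : 'I_n), L y = i :> nat -> y ord0 i < 0) /\
  (forall (y : 'rV[R]_n) (i : 'I_n), y ord0 i < 0 -> (L y <= i)%N).
Proof.
pose k (y : 'rV[R]_n) := find (fun i => y ord0 i < 0) (enum 'I_n).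
have kn y : (k y < n.+1)%N.
  by rewrite ltnS -[leqRHS](size_enum_ord n); exact: find_size.
exists (fun y => Ordinal (kn y)); split=> y i /= yi.
  have /(nth_find i) : has (fun i => y ord0 i < 0) (enum 'I_n).
    by rewrite has_find size_enum_ord -/(k y) yi.
  by rewrite -/(k y) yi nth_ord_enum.
rewrite leqNgt; apply/negP => /(before_find i).
by rewrite nth_ord_enum yi.
Qed.

(** A nearby label [i] forces [y i < eta], and a nearby label [n] forces [y i > - eta] for all [i].
    With all labels present, the squared norm would be at most [eta ^+ 2 *+ n], below 1. *)
Lemma sphere_label_missing (n : nat) (L : 'rV[R]_n -> 'I_n.+1) (y : 'rV[R]_n)
    (eta : R) (z : 'I_n.+1 -> 'rV[R]_n) :
  (forall (y : 'rV[R]_n) (i : 'I_n), L y = i :> nat -> y ord0 i < 0) ->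
  (forall (y : 'rV[R]_n) (i : 'I_n), y ord0 i < 0 -> (L y <= i)%N) ->
  eta ^+ 2 *+ n < 1 -> enorm y = 1 ->
  (forall a i, `|y ord0 i - z a ord0 i| < eta) -> exists a, L (z a) <> a.
Proof.
move=> L1 L2 eta1 y1 yz; apply: contrapT => H.
have {}H a : L (z a) = a by apply: contrapT => La; apply: H; exists a.
have yb i : `|y ord0 i| <= eta.
  have : y ord0 i < eta.
    have zi : z (widen_ord (leqnSn n) i) ord0 i < 0 by apply: L1; rewrite H.
    have := yz (widen_ord (leqnSn n) i) i; rewrite ltr_norml => /andP[]; lra.
  have zi : 0 <= z ord_max ord0 i.
    rewrite leNgt; apply/negP => /L2; rewrite H /= leqNgt; have := ltn_ord i; lia.
  have := yz ord_max i; rewrite ltr_norml ler_norml => /andP[? ?] ?.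
  by apply/andP; split; lra.
have := sqr_enorm y; rewrite y1 expr1n => /eqP; apply/negP; rewrite gt_eqF //.
apply: le_lt_trans eta1.
rewrite -[X in eta ^+ 2 *+ X]card_ord -sumr_const.
apply: ler_sum => i _; rewrite -real_normK ?num_real //.
by rewrite lerXn2r ?nnegrE // (le_trans _ (yb i)).
Qed.

Lemma sphere_no_factor (m n : nat)
    (f : unit_sphere R n.+1 -> unit_sphere R m)
    (g : unit_sphere R m -> unit_sphere R n.+1) :
  (m <= n)%N -> continuous f -> continuous g -> ~ homotopic R (g \o f) idfun.
Proof.
move=> mn fc gc /homotopic_continuous[h [hc h0 h1]].
have [L [L1 L2]] := first_negative n.+1.
pose eta : R := n.+2%:R^-1.
have eta0 : 0 < eta by rewrite invr_gt0.
have eta1 : eta ^+ 2 *+ n.+1 < 1.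
  rewrite /eta exprVn -mulr_natl ltr_pdivrMr ?exprn_gt0 // mul1r -natrX ltr_nat.
  by rewrite -mulnn; nia.
have [e e0 ge] := sphere_unif_continuous gc eta0.
(* One third of the modulus [e] is the side of a brick; the other two bound the distances of a brick
   from the two sphere points compared. *)
have e30 : 0 < e / 3 by rewrite divr_gt0.
pose M : R := 3 / e.
have M0 : 0 < M by rewrite divr_gt0.
pose P b (v : unit_sphere R m) := exists w : nat -> R,
  brick M w m = b /\ forall i : 'I_m, `|set_val v ord0 i - w i| < e / 3.
have [rep repP] : exists rep : seq int -> unit_sphere R m,
    forall b v, P b v -> P b (rep b).
  suff /choice[rep repP] : forall b, exists u, forall v, P b v -> P b u.
    by exists rep.
  move=> b; have [[u Pu]|H] := pselect (exists u, P b u); first by exists u.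
  (* For a brick away from the sphere any value will do; one exists because [f] has a nonempty
     source. *)
  by exists (f (radial 0)) => v Pv; case: H; exists v.
(* The factor is 0 up to norm 1/4 and 1 from norm 1/2 on, so [F] is continuous even at the origin,
   where [radial] takes a junk value. *)
pose s (x : 'rV[R]_n.+1) : R := clamp01 (4 * enorm x - 1).
pose F (x : 'rV[R]_n.+1) (i : nat) : R :=
  if insub i is Some j then s x * set_val (f (radial x)) ord0 j else 0.
have FE x (i : 'I_m) : F x i = s x * set_val (f (radial x)) ord0 i.
  by rewrite /F; case: insubP => [j _ /val_inj ->|] //; rewrite ltn_ord.
have enc := @enorm_continuous R n.+1.
have aff (a b : R) : continuous (fun y : 'rV[R]_n.+1 => a * enorm y - b).
  move=> y; apply: (@cvgB _ _ _ (nbhs y) _ (fun y => a * enorm y) (fun=> b)).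
    apply: (@cvgM _ _ (nbhs y) _ (fun=> a) (@enorm R n.+1)); last exact: enc.
    exact: cvg_cst.
  exact: cvg_cst.
have fcoord (x : 'rV[R]_n.+1) (i : 'I_m) : 0 < enorm x ->
    {for x, continuous (fun y => set_val (f (radial y)) ord0 i)}.
  move=> x0.
  apply: (@continuous_comp _ _ _
    (fun y => set_val (f (radial y))) (fun v : 'rV[R]_m => v ord0 i));
    last exact: coord_cont.
  apply: (@continuous_comp _ _ _
    (fun y => f (radial y)) (fun v : unit_sphere R m => set_val v));
    last exact: set_val_continuous.
  by apply: continuous_comp; [exact: radial_continuous|exact: fc].
have sc : continuous s.
  move=> x; apply: (@continuous_comp _ _ _
    (fun y : 'rV[R]_n.+1 => 4 * enorm y - 1) (@clamp01 R));
    last exact: clamp01_continuous.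
  exact: aff.
have Fc (x : 'rV[R]_n.+1) i : (i < m)%N -> {for x, continuous (fun y => F y i)}.
  move=> im; pose j := Ordinal im.
  rewrite -[i]/(nat_of_ord j); have [x0|x0] := leP (enorm x) 0; last first.
    have -> : (fun y => F y j) = (fun y => s y * set_val (f (radial y)) ord0 j).
      by apply/funext => y; rewrite FE.
    apply: (@cvgM _ _ (nbhs x) _ s (fun y => set_val (f (radial y)) ord0 j)).
      exact: sc.
    exact: fcoord.
  have near4 : \forall y \near x, enorm y < 1 / 4.
    apply: (@cvgr_lt _ _ (nbhs x) _ _ _ (enc x)); lra.
  change (F y j @[y --> x] --> F x j).
  have F0 y : enorm y < 1 / 4 -> 0 = F y j.
    by move=> y4; rewrite FE /s clamp01_le0 ?mul0r; lra.
  rewrite -F0; last by lra.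
  apply: (@cvg_trans _ ((0 : R) @[y --> x])); last exact: (@cvg_cst _ _ _ (nbhs x)).
  by apply: (@near_eq_cvg _ _ (nbhs x)); apply: (@filterS _ (nbhs x) _ _ _ _ near4) => y /F0.
(* The time is 0 at norm 1/2, where the value is [g (f (radial x))], and at least 1 from norm 3/4
   on, where it is [radial x]. *)
pose outer x := set_val (h (4 * enorm x - 2, radial x)).
pose inner x := set_val (g (rep (brick M (F x) m))).
(* Inner points get the label of their brick, outer points follow the homotopy
   from g o f to the identity: no label set is complete near any point. *)
pose lab x := if enorm x <= 1 / 2 then L (inner x) else L (outer x).
have outer1 x : 1 <= enorm x -> outer x = (enorm x)^-1 *: x.
  by move=> x1; rewrite /outer h1 ?set_val_radial //; lra.
(* A point on the boundary of the cube has norm at least 1, so its label is read off its own signs;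
   this gives both Sperner conditions. *)
have bdry (x : 'rV[R]_n.+1) i : `|x ord0 i| = 1 -> lab x = L ((enorm x)^-1 *: x) /\ 0 < enorm x.
  move=> xi; have := coord_le_enorm x i; rewrite xi => x1.
  split; last by lra.
  by rewrite /lab ifF ?outer1 //; lra.
have [x xP] : exists x : 'rV[R]_n.+1, forall U, nbhs x U ->
    forall a, exists2 y, U y & lab y = a.
  apply: cube_sperner => x _ i xi.
    have [|-> x0] := bdry x i; first by rewrite xi normrN normr1.
    by apply: L2; rewrite mxE xi mulrN1 oppr_lt0 invr_gt0.
  have [|-> x0] := bdry x i; first by rewrite xi normr1.
  by move=> /L1; rewrite mxE xi mulr1 invr_lt0 ltNge enorm_ge0.
(* Strictly inside, at most [m.+1] bricks occur near [x], each with one label, fewer than the [n.+2]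
   labels required. *)
have [x2|x2] := ltP (enorm x) (1 / 2).
  have [//|B Bm Bx] := @brick_order R M _ F x m.
    by move=> i im; exact: Fc.
  have near2 : \forall y \near x, enorm y < 1 / 2.
    exact: (@cvgr_lt _ _ (nbhs x) _ _ _ (enc x)).
  have labB a : a \in [seq L (set_val (g (rep b))) | b <- B].
    have [y [yB y2] <-] := xP _ (filterI Bx near2) a.
    by rewrite /lab (ltW y2); apply/mapP; exists (brick M (F y) m).
  have : (#|'I_n.+2| <= size B)%N.
    rewrite -(size_map (fun b => L (set_val (g (rep b))))).
    by rewrite cardE; apply: uniq_leq_size; [exact: enum_uniq|move=> a _].
  by rewrite card_ord; lia.
have x0 : 0 < enorm x by lra.
have outc : {for x, continuous outer}.
  apply: (@continuous_comp _ _ _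
    (fun y => h (4 * enorm y - 2, radial y)) (fun v : unit_sphere R n.+1 => set_val v));
    last exact: set_val_continuous.
  apply: (@continuous_comp _ _ _
    (fun y : 'rV[R]_n.+1 => (4 * enorm y - 2, radial y)) h);
    last exact: hc.
  apply: (@cvg_to_pair _ _ _ (nbhs x)); last exact: radial_continuous.
  exact: aff.
have near_outer : \forall y \near x, forall i, `|outer x ord0 i - outer y ord0 i| < eta.
  exact: (outc _ (rV_near (outer x) eta0)).
have near_inner : \forall y \near x, enorm y <= 1 / 2 ->
    forall i, `|outer x ord0 i - inner y ord0 i| < eta.
  have [x2'|xlt|xE] := ltgtP (enorm x) (1 / 2); first by move: x2; rewrite leNgt x2'.
    have : \forall y \near x, 1 / 2 < enorm y.
      exact: (@cvgr_gt _ _ (nbhs x) _ _ _ (enc x)).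
    by apply: filterS => y y2; rewrite leNgt y2.
  have sx : s x = 1 by rewrite /s clamp01_ge1 //; lra.
  have : \forall y \near x, forall i : 'I_m,
      `|set_val (f (radial x)) ord0 i - F y i| < e / 3.
    apply: (@filter_forall _ _ _ (nbhs x)) => i.
    have /cvgrPdist_lt/(_ _ e30) := Fc x i (ltn_ord i).
    by rewrite FE sx mul1r.
  apply: filterS => y Fy _.
  have Py : P (brick M (F y) m) (f (radial x)) by exists (F y).
  rewrite /outer h0 /=; last by lra.
  apply: ge => i.
  (* From [f (radial x)] to [F y], then to [w] in the same brick, then to the representative: three
     gaps below e / 3. *)
  have [w [wb wv]] := repP _ _ Py.
  have := Fy i; have := wv i; have := brick_dist M0 (ltn_ord i) wb.
  rewrite /M -ltr_pdivlMl ?divr_gt0 // mulr1 invf_div.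
  rewrite !ltr_norml => /andP[? ?] /andP[? ?] /andP[? ?].
  by apply/andP; split; lra.
have near_lab : \forall y \near x, exists2 z, lab y = L z &
    forall i, `|outer x ord0 i - z ord0 i| < eta.
  apply: filterS2 near_outer near_inner => y yo yi; rewrite /lab.
  by case: ifPn => [y2|y2]; [exists (inner y) => //; exact: yi|exists (outer y)].
have /choice[z zP] : forall a, exists z, L z = a /\
    forall i, `|outer x ord0 i - z ord0 i| < eta.
  by move=> a; have [y [z yz zi] <-] := xP _ near_lab a; exists z.
have [||a] := @sphere_label_missing n.+1 L (outer x) eta z L1 L2 eta1.
- exact: enorm_sphere.
- by move=> a i; exact: (zP a).2.
- by case; exact: (zP a).1.
Qed.

Lemma sphere_dimension_unique (X : topologicalType) (m n : nat) :
  homotopy_equivalent R X (unit_sphere R m) ->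
  homotopy_equivalent R X (unit_sphere R n) -> m = n.
Proof.
have no m' n' : (m' < n')%N ->
    ~ homotopy_equivalent R (unit_sphere R n') (unit_sphere R m').
  case: n' => // n' mn [f [g [fc gc gf _]]].
  by apply: (@sphere_no_factor m' n' f g).
move=> Xm Xn; case: (ltngtP m n) => // mn; exfalso; apply: (no _ _ mn).
  exact: homotopy_equivalent_trans (homotopy_equivalent_sym Xn) Xm.
exact: homotopy_equivalent_trans (homotopy_equivalent_sym Xm) Xn.
Qed.

End SphereDimension.

(** * Rank, atoms and coatoms in a geometric lattice *)

Section GeometricLatticeFacts.
Context {d : Order.disp_t} {L : finTBLatticeType d} (rk : L -> nat).
Hypothesis L_geometric : geometric_lattice rk.
Implicit Types x y z : L.

Lemma exists_cover x y : (x < y)%O -> exists2 z, covers x z & (z <= y)%O.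
Proof.
have [k] := ubnP #|[set z : L | (x < z)%O && (z < y)%O]|%SET.
elim: k y => // k IH y; rewrite ltnS => yk xy.
have [xcy|] := boolP (covers x y); first by exists y.
rewrite /covers xy /= => /forallPn[z /negPn/andP[xz zy]].
have [|//|w xw wz] := IH z.
  apply: leq_trans yk; apply: proper_card; apply/properP; split.
    apply/fintype.subsetP => w; rewrite !inE => /andP[-> wz]; exact: lt_trans wz zy.
  by exists z; rewrite !inE ?xz ?zy // ltxx andbF.
by exists w => //; apply: le_trans wz (ltW zy).
Qed.

(** [is_rank] speaks only of covers, so [y] is reached from [x] one cover at a time. *)
Lemma rank_lt x y : (x < y)%O -> (rk x < rk y)%N.
Proof.
have [[_ rkS] _ _] := L_geometric.
have [k] := ubnP #|[set z : L | (x < z)%O]|%SET.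
elim: k x => // k IH x; rewrite ltnS => xk xy.
have [z xz] := exists_cover xy; have zS := rkS _ _ xz.
rewrite le_eqVlt => /orP[/eqP <-|zy]; first by rewrite zS.
have {}xz : (x < z)%O by case/andP: xz.
apply: leq_trans (IH z _ zy); first by rewrite zS.
apply: leq_trans xk; apply: proper_card; apply/properP; split.
  by apply/fintype.subsetP => w; rewrite !inE; exact: lt_trans.
by exists z; rewrite !inE ?ltxx.
Qed.

Lemma rank_le x y : (x <= y)%O -> (rk x <= rk y)%N.
Proof. by rewrite le_eqVlt => /orP[/eqP ->|/rank_lt/ltnW]. Qed.

Lemma rank_eq x y : (x <= y)%O -> rk x = rk y -> x = y.
Proof.
move=> xy rxy; apply/eqP; apply: contraT => nxy.
by have := @rank_lt x y; rewrite lt_neqAle nxy xy rxy ltnn => /(_ isT).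
Qed.

Lemma rank_atom a : a \in atoms -> rk a = 1%N.
Proof.
by have [[rk0 rkS] _ _] := L_geometric; rewrite inE => /rkS ->; rewrite rk0.
Qed.

Lemma rank_join_atom a x : a \in atoms -> (rk (x `|` a)%O <= (rk x).+1)%N.
Proof.
have [_ _ sm] := L_geometric => /rank_atom ra.
by have := sm x a; rewrite ra addn1; apply: leq_trans; exact: leq_addl.
Qed.

Lemma rank_join_new_atom a x : a \in atoms -> ~~ (a <= x)%O ->
  rk (x `|` a)%O = (rk x).+1.
Proof.
move=> aA ax; apply/eqP; rewrite eqn_leq rank_join_atom //=.
by apply: rank_lt; rewrite lt_neqAle leUl andbT eq_sym eq_joinl.
Qed.

Lemma exists_atom x y : ~~ (y <= x)%O ->
  exists a, [/\ a \in atoms, (a <= y)%O & ~~ (a <= x)%O].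
Proof.
have [_ /(_ y)[B BA yE] _] := L_geometric.
move=> yx; apply: contrapT => H; case/negP: yx; rewrite {1}yE.
apply/joinsP => a aB; apply: contrapT => /negP ax; apply: H.
exists a; split=> //; first by have /fintype.subsetP/(_ a aB) := BA.
by rewrite yE; exact: joins_sup.
Qed.

(* A maximal element above x and not above y is a coatom: it is covered by a
   single element, since every cover of it is above y. *)
Lemma coatom_separation x y : ~~ (y <= x)%O ->
  exists2 H, H \in coat x & ~~ (y <= H)%O.
Proof.
have [k] := ubnP #|[set z : L | (x < z)%O]|%SET.
elim: k x => // k IH x; rewrite ltnS => xk yx.
have [[z /andP[xz yz]]|H] := pselect (exists z, (x < z)%O && ~~ (y <= z)%O).
  have [|//|H] := IH z.
    apply: leq_trans xk; apply: proper_card; apply/properP; split.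
      by apply/fintype.subsetP => w; rewrite !inE; exact: lt_trans.
    by exists z; rewrite !inE ?ltxx.
  rewrite inE => /andP[Hc zH] yH; exists H => //.
  by rewrite inE Hc /=; exact: le_trans (ltW xz) zH.
have above z : (x < z)%O -> (y <= z)%O.
  by move=> xz; apply: contrapT => /negP yz; apply: H; exists z; rewrite xz.
have [a [aA ay ax]] := exists_atom yx.
have xa : (x < x `|` a)%O by rewrite lt_neqAle leUl andbT eq_sym eq_joinl.
(* An atom [b] not below the join of [x] and [a] gives a join of [x] and [b] that is above [y],
   hence above [a]. The two joins are then comparable of equal rank, so they coincide, a
   contradiction. *)
have top : (x `|` a)%O = \top%O.
  apply: contrapT => /eqP nt; have ntt : (x `|` a < \top)%O by rewrite lt_neqAle nt lex1.
  have [b [bA _ bz]] : exists b, [/\ b \in atoms, (b <= \top)%O & ~~ (b <= x `|` a)%O].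
    by apply: exists_atom; rewrite lt_geF.
  have bx : ~~ (b <= x)%O by apply: contra bz => bx; exact: le_trans bx (leUl _ _).
  have xb : (x < x `|` b)%O by rewrite lt_neqAle leUl andbT eq_sym eq_joinl.
  case/negP: bz; suff -> : (x `|` a = x `|` b)%O by exact: leUr.
  apply: rank_eq; last by rewrite !rank_join_new_atom.
  by rewrite leUx leUl /= (le_trans ay) // above.
exists x => //; rewrite !inE lexx andbT /covers -top xa /=.
apply/forallP => z; apply/negP => /andP[/rank_lt xz /rank_lt].
by rewrite rank_join_new_atom // ltnS leqNgt xz.
Qed.

Lemma coatU x y : coat (x `|` y)%O = (coat x :&: coat y)%SET.
Proof. by apply/setP => H; rewrite !inE leUx; case: (covers H _). Qed.

Lemma coat_le x y : (coat y \subset coat x) = (x <= y)%O.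
Proof.
apply/idP/idP => [/fintype.subsetP yx|xy]; last first.
  by apply/fintype.subsetP => H; rewrite !inE => /andP[->] /=; exact: le_trans.
apply: contraT => /coatom_separation[H Hy]; apply: contraNT => _.
by have := yx _ Hy; rewrite inE => /andP[].
Qed.

(** * Flags and their blocks of coatoms *)

Section Flag.
Variables (r : nat) (F : 'I_r.+1 -> L).
Hypothesis F_flag : complete_flag F.

Lemma flag_le (i j : 'I_r.+1) : (i <= j)%N -> (F i <= F j)%O.
Proof.
have [_ _ Flt _] := F_flag.
by rewrite leq_eqVlt => /orP[/eqP/val_inj ->|/Flt/ltW].
Qed.

(** A coatom of an earlier block is not above the next flag element, whereas all coatoms of later
    blocks are. *)
Lemma flag_block_unique (i j : 'I_r) (H : L) :
  H \in flag_block F i -> H \in flag_block F j -> i = j.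
Proof.
have key (a b : 'I_r) : (a < b)%N -> H \in flag_block F a -> H \notin flag_block F b.
  move=> ab; rewrite /flag_block 2!finset.in_setD => /andP[Ha _]; apply/negP => /andP[_ Hb].
  case/negP: Ha; move: Hb; rewrite !inE => /andP[-> /=].
  by apply: le_trans; apply: flag_le; rewrite /= /bump; lia.
move=> Hi Hj; apply: val_inj; case: (ltngtP i j) => // ij.
  by have := key _ _ ij Hi; rewrite Hj.
by have := key _ _ ij Hj; rewrite Hi.
Qed.

Hypothesis rank_L : rk \top%O = r.

(** Strict growth bounds the rank from below counting up from the bottom, and from above counting
    down from the top, of rank [r]. *)
Lemma rank_flag (i : 'I_r.+1) : rk (F i) = i.
Proof.
have [F0 Fr Flt _] := F_flag; have [[rk0 _] _ _] := L_geometric.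
have lo (k : nat) : (k < r.+1)%N -> (k <= rk (F (inord k)))%N.
  elim: k => // k IH kr; apply: leq_ltn_trans (IH (ltnW kr)) _.
  by apply/rank_lt/Flt; rewrite !inordK // ltnW.
have hi (k : nat) : (k <= r)%N -> (rk (F (inord (r - k))) + k <= r)%N.
  elim: k => [|k IH] kr.
    rewrite addn0 subn0 -[leqRHS]rank_L -Fr; apply: rank_le; apply: flag_le.
    by rewrite inordK.
  apply: leq_trans (IH (ltnW kr)); rewrite addnS -addSn leq_add2r.
  by apply/rank_lt/Flt; rewrite !inordK; lia.
have ir : (i <= r)%N by rewrite -ltnS.
have := lo i (ltn_ord i); have := hi (r - i)%N (leq_subr _ _).
by rewrite subKn // inord_val; lia.
Qed.

(* Joined with G, two consecutive flag elements differ in rank by at most one,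
   and they are told apart by the coatoms above G in the corresponding block. *)
Lemma card_flag_blocks (G : L) :
  #|[set i : 'I_r | (coat G :&: flag_block F i != finset.set0)]|%SET = (r - rk G)%N.
Proof.
have [F0 Fr Flt _] := F_flag; have [_ _ sm] := L_geometric.
pose J (k : nat) := rk (G `|` F (inord k))%O.
have stepE (i : 'I_r) : (J i.+1 - J i)%N = (coat G :&: flag_block F i != finset.set0)%SET
    /\ (J i <= J i.+1)%N.
  have e1 : widen_ord (leqnSn r) i = inord i.
    by apply: val_inj; rewrite /= inordK; have := ltn_ord i; lia.
  have e2 : lift ord0 i = inord i.+1.
    by apply: val_inj; rewrite /= /bump inordK; have := ltn_ord i; lia.
  rewrite /flag_block e1 e2 /J; set x := F (inord i); set y := F (inord i.+1).
  have xy : (x <= y)%O by apply: flag_le; rewrite -e1 -e2 /= /bump; lia.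
  have Jle : (G `|` x <= G `|` y)%O by exact: leU2.
  have Jr := rank_le Jle.
  split=> //.
  (* Semimodularity is applied to [G v x] and [y], whose meet is above [x], with
     [rk y = (rk x).+1]. *)
  have Jle1 : (rk (G `|` y)%O <= (rk (G `|` x)%O).+1)%N.
    have := sm (G `|` x)%O y; rewrite -joinA (join_r xy).
    have : (rk x <= rk ((G `|` x) `&` y)%O)%N by apply: rank_le; rewrite lexI leUr xy.
    have -> : rk y = (rk x).+1 by rewrite /x /y -e1 -e2 !rank_flag /= /bump; lia.
    move=> h1 h2; rewrite -(leq_add2l (rk x)) addnS [X in (_ <= X.+1)%N]addnC -addnS.
    by apply: leq_trans h2; rewrite leq_add2r.
  (* Joins become intersections of coatom sets, so an empty block means that every coatom above
     [G v x] is above [G v y]. *)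
  have -> : (coat G :&: (coat x :\: coat y) == finset.set0)%SET = (G `|` y <= G `|` x)%O.
    rewrite -coat_le !coatU.
    apply/eqP/fintype.subsetP => [/setP H K|H]; last apply/setP => K; have := H K; rewrite !inE.
      have := H K; rewrite !inE.
      by case: (covers K _); case: (G <= K)%O; case: (x <= K)%O; case: (y <= K)%O.
    case: (covers K _); case: (G <= K)%O; case: (x <= K)%O; case: (y <= K)%O => //=.
    by move/(_ isT).
  have [yx|yx] := boolP (G `|` y <= G `|` x)%O.
    by have := rank_le yx; rewrite /=; lia.
  have : (rk (G `|` x)%O < rk (G `|` y)%O)%N.
    by apply: rank_lt; rewrite lt_neqAle Jle andbT; apply: contraNneq yx => ->.
  by rewrite /=; lia.
have J0 : J 0%N = rk G.
  rewrite /J; have -> : inord 0 = ord0 :> 'I_r.+1 by apply: val_inj; rewrite /= inordK.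
  by rewrite F0 joinx0.
have Jlast : J r = r.
  rewrite /J; have -> : inord r = ord_max :> 'I_r.+1 by apply: val_inj; rewrite /= inordK.
  by rewrite Fr joinx1.
(* The increments of [J], each 0 or 1, telescope from [rk G] to [r]. *)
rewrite -sum1dep_card -J0 -[in RHS]Jlast.
rewrite -(telescope_sumn_in (f := J)) //; last first.
  by move=> k /andP[_ kr]; exact: (stepE (Ordinal kr)).2.
rewrite big_mkord big_mkcond /=; apply: eq_bigr => i _.
by rewrite (stepE i).1; case: (_ != _).
Qed.

End Flag.
End GeometricLatticeFacts.

(** * Fattened cross-polytopes are homotopy spheres *)

Section CrossPolytope.
Variables (R : realType) (T : finType) (r : nat) (A : 'I_r -> {set T}).
Hypothesis A_disjoint : forall i j H, H \in A i -> H \in A j -> i = j.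

Definition cross_polytope : {set {set T * bool}} :=
  [set s : {set T * bool} | [exists e : {ffun 'I_r -> bool},
    s \subset (\bigcup_(i < r) [set (H, e i) | H in A i])%SET]]%SET.

(** Empty blocks add nothing to a facet, so the sphere has one coordinate per nonempty block. *)
Let J : {set 'I_r} := [set i : 'I_r | A i != finset.set0]%SET.
Let block (k : 'I_#|J|) : 'I_r := enum_val k.

Let vertexP (k : 'I_#|J|) : {H | H \in A (block k)}.
Proof.
have : block k \in J by exact: enum_valP.
by rewrite inE => /finset.set0Pn/sigW.
Qed.
Let vertex k : T := sval (vertexP k).

Let vertex_in k : vertex k \in A (block k).
Proof. exact: (svalP (vertexP k)). Qed.

Let block_inj : injective block.
Proof. exact: enum_val_inj. Qed.

Let block_ex i H : H \in A i -> exists k, block k = i.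
Proof.
move=> HA; have iJ : i \in J by rewrite inE; apply/finset.set0Pn; exists H.
by exists (enum_rank_in iJ i); rewrite /block enum_rankK_in.
Qed.

Let fits (e : {ffun 'I_r -> bool}) (x : T * bool -> R) :=
  forall v, x v != 0 -> exists2 k, v.1 \in A (block k) & v.2 = e (block k).

Let realizationP (x : {ptws T * bool -> R}) :
  realization R cross_polytope x <->
  [/\ forall v, 0 <= x v, \sum_v x v = 1 & exists e, fits e x].
Proof.
split=> -[x0 x1 xK]; split=> //.
  move: xK; rewrite inE => /existsP[e /fintype.subsetP xe]; exists e => v xv.
  have : v \in [set v | x v != 0]%SET by rewrite inE.
  move/xe/finset.bigcupP => [i _ /imsetP[H HA ->]].
  by have [k ki] := block_ex HA; exists k; rewrite ki.
rewrite inE; have [e xe] := xK; apply/existsP; exists e.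
apply/fintype.subsetP => v; rewrite inE => /xe[k vA ve].
apply/finset.bigcupP; exists (block k) => //; apply/imsetP; exists v.1 => //.
by rewrite -ve; case: (v).
Qed.

Let signed (x : T * bool -> R) (k : 'I_#|J|) : R :=
  \sum_(H in A (block k)) (x (H, true) - x (H, false)).

(** Within a facet each block carries a single sign, so nothing cancels: the absolute signed mass is
    the total mass of the block. *)
Let norm_signed e x : (forall v, 0 <= x v) -> fits e x -> forall k,
  `|signed x k| = \sum_(H in A (block k)) (x (H, true) + x (H, false)) /\
  (signed x k != 0 -> (0 < signed x k) = e (block k)).
Proof.
move=> x0 xe k.
have z H b : H \in A (block k) -> b != e (block k) -> x (H, b) = 0.
  move=> HA be; apply: contrapT => /eqP /xe[k' /= HA' be'].
  by move: be; rewrite be' (A_disjoint HA HA') eqxx.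
have p b : 0 <= \sum_(H in A (block k)) x (H, b) by exact: sumr_ge0.
case ek : (e (block k)).
  have zf : \sum_(H in A (block k)) x (H, false) = 0.
    by apply: big1 => H HA; apply: z; rewrite // ek.
  rewrite /signed sumrB big_split /= zf subr0 addr0 ger0_norm //; split=> // n0.
  by rewrite lt_neqAle eq_sym n0 p.
have zt : \sum_(H in A (block k)) x (H, true) = 0.
  by apply: big1 => H HA; apply: z; rewrite // ek.
rewrite /signed sumrB big_split /= zt sub0r add0r normrN ger0_norm //; split=> // _.
by apply/negbTE; rewrite -leNgt oppr_le0.
Qed.

Let sum_pair_bool (f : T * bool -> R) :
  \sum_v f v = \sum_H (f (H, true) + f (H, false)).
Proof.
transitivity (\sum_H \sum_b f (H, b)).
  by rewrite pair_bigA; apply: eq_bigr => -[].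
by apply: eq_bigr => H _; rewrite big_bool.
Qed.

Let sum_norm_signed e x : (forall v, 0 <= x v) -> fits e x ->
  \sum_k `|signed x k| = \sum_v x v.
Proof.
move=> x0 xe; under eq_bigr do rewrite (norm_signed x0 xe _).1.
rewrite (exchange_big_dep predT) //=.
transitivity (\sum_H (x (H, true) + x (H, false))).
  apply: eq_bigr => H _.
  have [[k HA]|nH] := pselect (exists k, H \in A (block k)).
    rewrite (big_pred1 k) // => k'; apply/idP/eqP => [HA'|->//].
    exact/block_inj/(A_disjoint HA' HA).
  rewrite big_pred0 => [|k]; last by apply/negP => HA; apply: nH; exists k.
  have z b : x (H, b) = 0.
    by apply: contrapT => /eqP /xe[k /= HA _]; apply: nH; exists k.
  by rewrite !z addr0.
by rewrite sum_pair_bool.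
Qed.

Let row (x : T * bool -> R) : 'rV[R]_#|J| := \row_k signed x k.

Let row_gt0 x : realization R cross_polytope x -> 0 < enorm (row x).
Proof.
move=> /realizationP[x0 x1 [e xe]]; rewrite lt_neqAle enorm_ge0 andbT eq_sym.
apply/negP => /eqP n0; have := sum_norm_signed x0 xe; rewrite x1 big1.
  by move/eqP; rewrite eq_sym oner_eq0.
move=> k _; apply/eqP; rewrite eq_le normr_ge0 andbT -n0.
by have := coord_le_enorm (row x) k; rewrite mxE.
Qed.

Let to_sphere_in (x : realization R cross_polytope) :
  (enorm (row (set_val x)))^-1 *: row (set_val x) \in unit_sphere R #|J|.
Proof.
apply/mem_set/unit_sphereP; have x0 := row_gt0 (set_valP x).
by rewrite enormZ gtr0_norm ?invr_gt0 // mulVf // gt_eqF.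
Qed.

Let to_sphere (x : realization R cross_polytope) : unit_sphere R #|J| :=
  exist (fun y => y \in unit_sphere R #|J|) _ (to_sphere_in x).

Let norm1 (y : 'rV[R]_#|J|) : R := \sum_k `|y ord0 k|.
(** The positive part of [t] for [true], the negative part for [false]. *)
Let part (b : bool) (t : R) : R := (`|t| + (-1) ^+ (~~ b) * t) / 2.
(** The parts of each coordinate are put on the two signed copies of one chosen vertex of its block,
    and the masses are scaled to total 1. *)
Let from_row (y : 'rV[R]_#|J|) (v : T * bool) : R :=
  (\sum_(k | vertex k == v.1) part v.2 (y ord0 k)) / norm1 y.

Let part_ge0 b t : 0 <= part b t.
Proof.
by rewrite /part; case: b; rewrite /= ?expr0 ?expr1; case: (ger0P t) => ?; lra.
Qed.

Let part_neq0 b t : part b t != 0 -> t != 0 /\ b = (0 < t).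
Proof.
move=> H; have [t0|t0|t0] := ltgtP t 0; move: H.
- rewrite /part ltr0_norm //; case: b; rewrite /= ?expr0 ?expr1; last by [].
  by rewrite mul1r addNr mul0r eqxx.
- rewrite /part gtr0_norm //; case: b; rewrite /= ?expr0 ?expr1; first by [].
  by rewrite mulN1r subrr mul0r eqxx.
- by rewrite t0 /part normr0 mulr0 addr0 mul0r eqxx.
Qed.

Let from_row_fits (e : {ffun 'I_r -> bool}) (y : 'rV[R]_#|J|) :
  (forall k, y ord0 k != 0 -> (0 < y ord0 k) = e (block k)) ->
  fits e (from_row y).
Proof.
move=> ye v vn0.
have /existsP[k /andP[/eqP kv pk]] :
    [exists k, (vertex k == v.1) && (part v.2 (y ord0 k) != 0)].
  apply: contraNT vn0 => /existsPn H; apply/eqP; rewrite /from_row big1 ?mul0r //.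
  by move=> k kv; have := H k; rewrite kv /= => /negPn/eqP.
exists k; first by rewrite -kv.
by have [y0 ->] := part_neq0 pk; exact: ye.
Qed.

Let from_row_realization (y : 'rV[R]_#|J|) : 0 < norm1 y ->
  realization R cross_polytope (from_row y).
Proof.
move=> y0; apply/realizationP; split.
- move=> v; apply: divr_ge0; last exact: ltW.
  by apply: sumr_ge0 => k _; exact: part_ge0.
- rewrite -mulr_suml; apply: (canLR (mulfK _)); rewrite ?gt_eqF // mul1r.
  rewrite sum_pair_bool /= big_split /=.
  rewrite (exchange_big_dep predT) //= [X in _ + X](exchange_big_dep predT) //=.
  rewrite -big_split /=; apply: eq_bigr => k _.
  rewrite !(big_pred1 (vertex k)) => [|H|H]; last 2 first.
  + exact: eq_sym.
  + exact: eq_sym.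
  by rewrite /part /= expr0 expr1; lra.
- exists [ffun i => [exists k, (block k == i) && (0 < y ord0 k)]].
  apply: from_row_fits => k _; rewrite ffunE; apply/idP/existsP => [yk|[k']].
    by exists k; rewrite eqxx.
  by case/andP => /eqP/block_inj ->.
Qed.

Let norm1_sphere (y : unit_sphere R #|J|) : 0 < norm1 (set_val y).
Proof.
rewrite lt_neqAle (_ : 0 <= norm1 _); last exact: sumr_ge0.
rewrite andbT; apply/negP => /eqP y0.
have := sqr_enorm (set_val y); rewrite enorm_sphere expr1n big1 => [/eqP|k _].
  by rewrite oner_eq0.
have /eqP := esym y0; rewrite psumr_eq0 // => /allP/(_ k).
rewrite mem_index_enum normr_eq0 => /(_ isT)/eqP ->; exact: expr0n.
Qed.

Let from_sphere (y : unit_sphere R #|J|) : realization R cross_polytope :=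
  exist (fun x => x \in realization R cross_polytope) _
    (mem_set (from_row_realization (norm1_sphere y))).

Let signed_from_row (y : 'rV[R]_#|J|) k :
  signed (from_row y) k = y ord0 k / norm1 y.
Proof.
rewrite /signed /from_row /=.
under eq_bigr do rewrite -mulrBl -sumrB.
rewrite -mulr_suml; congr (_ / _).
rewrite (exchange_big_dep predT) //= (bigD1 k) //= [X in _ + X]big1 ?addr0.
  rewrite (big_pred1 (vertex k)) => [|H].
    by rewrite /part /= expr0 expr1; lra.
  apply/andP/eqP => [[_ /eqP ->]//|->]; by rewrite vertex_in eqxx.
move=> k' kk'; rewrite big_pred0 // => H; apply/negP => /andP[HA /eqP vH].
case/eqP: kk'; apply: block_inj; apply: A_disjoint (vertex_in k') _.
by rewrite vH.
Qed.

Let to_from (y : unit_sphere R #|J|) : to_sphere (from_sphere y) = y.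
Proof.
apply: val_inj => /=; rewrite set_valE /=.
have y0 := norm1_sphere y.
have -> : row (from_row (set_val y)) = (norm1 (set_val y))^-1 *: set_val y.
  by apply/rowP => k; rewrite !mxE signed_from_row mulrC.
rewrite enormZ enorm_sphere mulr1 gtr0_norm ?invr_gt0 // invrK scalerA divff ?scale1r //.
by rewrite gt_eqF.
Qed.

Let segment (t : R) (x : {ptws T * bool -> R}) (v : T * bool) : R :=
  (1 - t) * x v + t * from_row (row x) v.

Let norm1_row (x : realization R cross_polytope) : 0 < norm1 (row (set_val x)).
Proof.
have /realizationP[x0 x1 [e xe]] := set_valP x.
by rewrite /norm1; under eq_bigr do rewrite mxE; rewrite (sum_norm_signed x0 xe) x1.
Qed.

(** The signs of [row x] are those of a facet carrying [x], so that facet also carries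
    [from_row (row x)] and, by convexity, the segment. *)
Let segment_in (t : R) (x : realization R cross_polytope) : 0 <= t <= 1 ->
  realization R cross_polytope (segment t (set_val x)).
Proof.
move=> /andP[t0 t1].
have /realizationP[x0 x1 [e xe]] := set_valP x.
have /realizationP[y0 y1 _] := from_row_realization (norm1_row x).
apply/realizationP; split.
- move=> v; have := x0 v; have := y0 v; rewrite /segment => yv xv.
  by rewrite addr_ge0 // mulr_ge0 // subr_ge0.
- by rewrite big_split /= -!mulr_sumr x1 y1 !mulr1 subrK.
- exists e => v; rewrite /segment.
  have [xv|xv _] := eqVneq (set_val x v) 0; last exact: xe.
  rewrite xv mulr0 add0r mulf_eq0 negb_or => /andP[_].
  by apply: from_row_fits => k; rewrite mxE; exact: (norm_signed x0 xe k).2.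
Qed.

Let segment_real (p : R * realization R cross_polytope) :
    realization R cross_polytope :=
  exist (fun x => x \in realization R cross_polytope) _
    (mem_set (segment_in p.2 (clamp01_itv p.1))).

Let cvg_ptws_coord (U : Type) (F : set_system U) (FF : Filter F)
    (f : U -> {ptws T * bool -> R}) (a : {ptws T * bool -> R}) :
  (forall v, f u v @[u --> F] --> a v) -> f @ F --> a.
Proof.
move=> H; apply/cvg_sup => v W [_ [[B Bop <-] Ba BW]].
have /H FB : nbhs (a v) B by apply: open_nbhs_nbhs.
by apply: (@filterS _ F _ ((fun u => f u v) @^-1` B)) => // u; exact: BW.
Qed.

Let eval_cont v : continuous (fun x : {ptws T * bool -> R} => x v).
Proof. exact: (@proj_continuous _ (fun=> R) v). Qed.

Let signed_cont k : continuous (fun x : {ptws T * bool -> R} => signed x k).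
Proof.
by move=> x; apply: (@cvg_sumr _ _ (nbhs x)) => H _; apply: cvgB; exact: eval_cont.
Qed.

Let row_cont : continuous (row : {ptws T * bool -> R} -> _).
Proof.
move=> x; apply: (@cvg_rV _ _ (nbhs x)) => k.
have -> : (fun u : {ptws T * bool -> R} => row u ord0 k) = (fun u => signed u k).
  by apply/funext => u; rewrite mxE.
have -> : row x ord0 k = signed x k by rewrite mxE.
exact: signed_cont.
Qed.

Let part_cont b : continuous (part b).
Proof.
move=> t; apply: cvgM; last exact: cvg_cst.
by apply: cvgD; [exact: norm_continuous|apply: cvgM; [exact: cvg_cst|exact: cvg_id]].
Qed.

Let from_row_cont (y : 'rV[R]_#|J|) : 0 < norm1 y ->
  {for y, continuous (from_row : _ -> {ptws T * bool -> R})}.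
Proof.
move=> y0; apply: (@cvg_ptws_coord _ (nbhs y)) => v.
apply: (@cvgM _ _ (nbhs y) _ (fun y => \sum_(k | vertex k == v.1) part v.2 (y ord0 k))
  (fun y => (norm1 y)^-1)).
  apply: (@cvg_sumr _ _ (nbhs y)) => k _.
  apply: (@continuous_comp _ _ _ (fun y : 'rV[R]_#|J| => y ord0 k) (part v.2)).
    exact: coord_cont.
  exact: part_cont.
apply: (@cvgV _ _ (nbhs y)); first by rewrite gt_eqF.
apply: (@cvg_sumr _ _ (nbhs y)) => k _.
by apply: (@cvg_norm _ _ _ (nbhs y)); exact: coord_cont.
Qed.

(** Scale invariance absorbs the normalization in [to_sphere], so a round trip ends at
    [from_row (row x)]. *)
Let from_rowZ (a : R) (y : 'rV[R]_#|J|) : 0 < a ->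
  from_row (a *: y) = from_row y.
Proof.
move=> a0; apply/funext => v; rewrite /from_row.
have -> : norm1 (a *: y) = a * norm1 y.
  by rewrite /norm1 mulr_sumr; apply: eq_bigr => k _; rewrite mxE normrM gtr0_norm.
have -> : \sum_(k | vertex k == v.1) part v.2 ((a *: y) ord0 k) =
          a * \sum_(k | vertex k == v.1) part v.2 (y ord0 k).
  rewrite mulr_sumr; apply: eq_bigr => k _.
  by rewrite mxE /part normrM gtr0_norm // mulrCA -mulrDr mulrA.
by rewrite -mulf_div divff ?mul1r // gt_eqF.
Qed.

Let from_to (x : realization R cross_polytope) v :
  set_val (from_sphere (to_sphere x)) v = from_row (row (set_val x)) v.
Proof.
have e : set_val (to_sphere x) =
    (enorm (row (set_val x)))^-1 *: row (set_val x) by rewrite set_valE.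
transitivity (from_row (set_val (to_sphere x)) v); first by rewrite set_valE.
by rewrite e from_rowZ // invr_gt0; exact: (row_gt0 (set_valP x)).
Qed.

Let set_val_cont : continuous (fun x : realization R cross_polytope => set_val x).
Proof. exact: set_val_continuous. Qed.

Let row_val_cont :
  continuous (fun x : realization R cross_polytope => row (set_val x)).
Proof.
move=> x; apply: (@continuous_comp _ _ _
  (fun x : realization R cross_polytope => set_val x) row); last exact: row_cont.
exact: set_val_cont.
Qed.

Let to_sphere_cont : continuous to_sphere.
Proof.
move=> x; apply: (@cvg_set_type _ _ _ (nbhs x)).
apply: (@cvg_rV _ _ (nbhs x)) => k.
have e z : set_val (to_sphere z) ord0 k =
    (enorm (row (set_val z)))^-1 * row (set_val z) ord0 k by rewrite set_valE /= mxE.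
rewrite e (_ : (fun z => set_val (to_sphere z) ord0 k) = fun z =>
    (enorm (row (set_val z)))^-1 * row (set_val z) ord0 k); last exact/funext.
apply: (@cvgM _ _ (nbhs x) _ (fun z : realization R cross_polytope =>
  (enorm (row (set_val z)))^-1) (fun z => row (set_val z) ord0 k)).
  apply: (@cvgV _ _ (nbhs x)); first by rewrite gt_eqF //; exact: (row_gt0 (set_valP x)).
  apply: (@continuous_comp _ _ _ (fun z : realization R cross_polytope =>
    row (set_val z)) (@enorm R #|J|)); last exact: enorm_continuous.
  exact: row_val_cont.
apply: (@continuous_comp _ _ _ (fun z : realization R cross_polytope =>
  row (set_val z)) (fun y : 'rV[R]_#|J| => y ord0 k)); last exact: coord_cont.
exact: row_val_cont.
Qed.

Let from_sphere_cont : continuous from_sphere.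
Proof.
move=> y; apply: (@cvg_set_type _ _ _ (nbhs y)).
apply: (@continuous_comp _ _ _ (fun z : unit_sphere R #|J| => set_val z)
  (from_row : _ -> {ptws T * bool -> R})).
  exact: set_val_continuous.
exact: (from_row_cont (norm1_sphere y)).
Qed.

Let segment_cont : continuous segment_real.
Proof.
move=> [t x]; apply: (@cvg_set_type _ _ _ (nbhs (t, x))).
apply: (@cvg_ptws_coord _ (nbhs (t, x))) => v.
have clampc : {for (t, x), continuous (fun p : R * realization R cross_polytope => clamp01 p.1)}.
  apply: (@continuous_comp _ _ _ (fun p : R * realization R cross_polytope => p.1)
    (@clamp01 R)); first exact: cvg_fst.
  exact: clamp01_continuous.
have rowc : {for (t, x), continuous (fun p : R * realization R cross_polytope => row (set_val p.2))}.
  apply: (@continuous_comp _ _ _ (fun p : R * realization R cross_polytope => p.2)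
    (fun x : realization R cross_polytope => row (set_val x))); first exact: cvg_snd.
  exact: row_val_cont.
have valc : {for (t, x), continuous (fun p : R * realization R cross_polytope => set_val p.2 v)}.
  apply: (@continuous_comp _ _ _ (fun p : R * realization R cross_polytope => p.2)
    (fun x : realization R cross_polytope => set_val x v)); first exact: cvg_snd.
  apply: (@continuous_comp _ _ _ (fun x : realization R cross_polytope => set_val x)
    (fun x : {ptws T * bool -> R} => x v)); first exact: set_val_cont.
  exact: eval_cont.
have fromc : {for (t, x), continuous (fun p : R * realization R cross_polytope => 
    from_row (row (set_val p.2)) v)}.
  apply: (@continuous_comp _ _ _ (fun p : R * realization R cross_polytope =>
    row (set_val p.2)) (fun y => from_row y v)); first exact: rowc.
  apply: (@continuous_comp _ _ _ (from_row : _ -> {ptws T * bool -> R})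
    (fun x : {ptws T * bool -> R} => x v)); last exact: eval_cont.
  exact: (from_row_cont (norm1_row x)).
have clamp1c : {for (t, x), continuous (fun p : R * realization R cross_polytope => 1 - clamp01 p.1)}.
  by apply: continuousB; [exact: cst_continuous|exact: clampc].
exact: (continuousD (continuousM clamp1c valc) (continuousM clampc fromc)).
Qed.

Lemma cross_polytope_sphere :
  homotopy_equivalent R (realization R cross_polytope) (unit_sphere R #|J|).
Proof.
exists to_sphere, from_sphere; split => //.
(* Time runs backwards, since the homotopy must start at the round trip and end at the identity. *)
- apply: (@continuous_homotopic _ _ _ _ _ (fun p => segment_real (1 - p.1, p.2))).
  + move=> [t x]; apply: (@continuous_comp _ _ _
      (fun p : R * realization R cross_polytope => (1 - p.1, p.2)) segment_real).
      have c1 : {for (t, x), continuous (fun p : R * realization R cross_polytope => 1 - p.1)}.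
        by apply: continuousB; [exact: cst_continuous|exact: cvg_fst].
      by apply: (@cvg_to_pair _ _ _ (nbhs (t, x))); [exact: c1|exact: cvg_snd].
    exact: segment_cont.
  + move=> x; apply: val_inj; apply/funext => v; rewrite /= subr0.
    rewrite clamp01_ge1 // /segment subrr mul0r add0r mul1r.
    by rewrite -from_to set_valE.
  + move=> x; apply: val_inj; apply/funext => v; rewrite /= subrr.
    by rewrite clamp01_le0 // /segment subr0 mul1r mul0r addr0 set_valE.
- have -> : to_sphere \o from_sphere = idfun by apply/funext => y /=; rewrite to_from.
  by apply: (@continuous_homotopic _ _ _ _ _ snd) => // p; exact: cvg_snd.
Qed.

End CrossPolytope.

(** * The flag complexes and their arrangement *)

Section FlagComplex.
Context {d : Order.disp_t} {L : finTBLatticeType d} (r : nat) (F : 'I_r.+1 -> L).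
Implicit Types (G H : L) (e : {ffun 'I_r -> bool}).

Lemma flag_facetP G e (v : L * bool) :
  reflect (exists i, [/\ v.1 \in coat G, v.1 \in flag_block F i & v.2 = e i])
    (v \in flag_facet F G e).
Proof.
apply: (iffP finset.bigcupP) => [[i _ /imsetP[H]]|[i [vG vi ve]]].
  by rewrite inE => /andP[HG Hi] ->; exists i.
exists i => //; apply/imsetP; exists v.1; first by rewrite inE vG.
by rewrite -ve; case: (v).
Qed.

Lemma flag_complexP G (s : {set L * bool}) :
  reflect (exists e, forall v, v \in s -> v \in flag_facet F G e)
    (s \in flag_complex F G).
Proof.
rewrite inE; apply: (iffP existsP) => -[e se]; exists e.
  by move=> v; exact: (fintype.subsetP se).
exact/fintype.subsetP.
Qed.

Lemma flag_complex_simplicial G : simplicial_complex (flag_complex F G).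
Proof.
split=> [|s t /flag_complexP[e se] /fintype.subsetP ts].
  by apply/flag_complexP; exists [ffun=> true] => v; rewrite inE.
by apply/flag_complexP; exists e => v /ts; exact: se.
Qed.

Definition flip (v : L * bool) (g : 'Z_2) : L * bool := (v.1, v.2 (+) (g != 1%g)).

Lemma flip1 : flip^~ 1%g =1 id.
Proof. by case=> H b; rewrite /flip eqxx addbF. Qed.

Lemma flipM v : act_morph flip v.
Proof.
case: v => H b g h; rewrite /flip /= -addbA; congr (_, _ (+) _).
by case: g => [[|[|//]] ?]; case: h => [[|[|//]] ?].
Qed.

Definition flip_action : {action 'Z_2 &-> L * bool} := TotalAction flip1 flipM.

Lemma flag_complex_flip G (g : 'Z_2) s :
  s \in flag_complex F G -> (flip_action^*)%act s g \in flag_complex F G.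
Proof.
move=> /flag_complexP[e se]; apply/flag_complexP.
exists [ffun i => e i (+) (g != 1%g)] => _ /imsetP[v /se/flag_facetP[i [vG vi ve]] ->].
by apply/flag_facetP; exists i; split=> //=; rewrite ffunE ve.
Qed.

Lemma flag_complex_acts G : [acts [set: 'Z_2]%SET, on flag_complex F G | flip_action^*].
Proof.
apply/actsP => g _ s; apply/idP/idP => [sG|]; last exact: flag_complex_flip.
by rewrite -(actK (flip_action^*) g s); exact: flag_complex_flip.
Qed.

(** The support of a fixed point would contain both copies of some coatom; that coatom lies in a
    single block, to which a facet gives only one sign. *)
Lemma flag_complex_free (R : realType) G :
  (forall i j H, H \in flag_block F i -> H \in flag_block F j -> i = j) ->
  free_Z2_action R (flag_complex F G) flip_action.
Proof.
move=> Funiq; split=> [|g x g1 [x0 x1 /flag_complexP[e xe]] gx].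
  exact: flag_complex_acts.
have [v xv] : exists v, x v != 0.
  apply: contrapT => H; move: x1; rewrite big1 => [/eqP|v _].
    by rewrite eq_sym oner_eq0.
  by apply: contrapT => /eqP xv; apply: H; exists v.
have xg : x (v.1, ~~ v.2) != 0.
  have -> : (v.1, ~~ v.2) = flip_action v g^-1%g.
    by rewrite /= /flip invg_eq1 g1 addbT.
  by have /(congr1 (fun f => f v)) := gx => ->.
have /flag_facetP[i [_ vi ve]] : v \in flag_facet F G e by apply: xe; rewrite inE.
have /flag_facetP[j [_ vj]] : (v.1, ~~ v.2) \in flag_facet F G e.
  by apply: xe; rewrite inE.
by rewrite /= ve (Funiq _ _ _ vi vj); case: (e j).
Qed.

Variable rk : L -> nat.
Hypothesis L_geometric : geometric_lattice rk.
Hypothesis rank_L : rk \top%O = r.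
Hypothesis F_flag : complete_flag F.

(** For a common simplex the signs of the facet for [G] serve again; the facet for [H] only supplies
    that its coatoms are above [H]. *)
Lemma flag_complexU G H :
  (flag_complex F G :&: flag_complex F H)%SET = flag_complex F (G `|` H)%O.
Proof.
apply/setP => s; rewrite inE.
apply/andP/flag_complexP => [[/flag_complexP[e se] /flag_complexP[e' se']]|[e se]].
  exists e => v vs; have /flag_facetP[i [vG vi ve]] := se _ vs.
  have /flag_facetP[_ [vH _ _]] := se' _ vs.
  by apply/flag_facetP; exists i; rewrite coatU inE vG vH.
by split; apply/flag_complexP; exists e => v /se/flag_facetP[i [+ vi ve]];
  rewrite coatU inE => /andP[vG vH]; apply/flag_facetP; exists i.
Qed.

Lemma flag_complex_sphere (R : realType) G :
  homotopy_equivalent R (realization R (flag_complex F G)) (unit_sphere R (r - rk G)).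
Proof.
rewrite -(card_flag_blocks L_geometric F_flag rank_L).
apply: (@cross_polytope_sphere R L r (fun i => coat G :&: flag_block F i)%SET).
move=> i j H /finset.setIP[_ Hi] /finset.setIP[_ Hj].
exact: (flag_block_unique F_flag Hi Hj).
Qed.

Lemma flag_complex_homotopy_sphere (R : realType) G :
  homotopy_sphere R (flag_complex F G) (r%:Z - (rk G)%:Z - 1).
Proof.
exists (r - rk G)%N; last exact: flag_complex_sphere.
by rewrite -subzn // -rank_L; apply: (rank_le L_geometric); exact: lex1.
Qed.

(** Members are removed one at a time, each intersection becoming a join; the empty family gives the
    complex of the bottom element. *)
Lemma intersection_flag_complex (B : {set {set {set L * bool}}}) :
  B \subset [set flag_complex F G | G in @atoms d L]%SET ->
  exists G, intersection_in (flag_complex F \bot%O) B = flag_complex F G.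
Proof.
have [k] := ubnP #|B|; elim: k B => // k IH B; rewrite ltnS => Bk BA.
have [->|[T TB]] := set_0Vmem B.
  by exists \bot%O; rewrite /intersection_in big_set0 finset.setIT.
have [||G GE] := IH (B :\ T)%SET.
- by move: Bk; rewrite (cardsD1 T) TB.
- by apply: fintype.subset_trans BA; exact: subD1set.
have /imsetP[a _ Ta] := fintype.subsetP BA _ TB.
exists (G `|` a)%O; rewrite -flag_complexU -GE -Ta /intersection_in.
by rewrite (big_setD1 T TB) /= finset.setIA finset.setIAC.
Qed.

Lemma flag_complex_arrangement (R : realType) :
  homotopy_arrangement R (r%:Z - 1) (flag_complex F \bot%O)
    [set flag_complex F G | G in @atoms d L]%SET.
Proof.
have [[rk0 _] _ _] := L_geometric.
have sph := flag_complex_homotopy_sphere R.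
split.
- exact: flag_complex_simplicial.
- move=> _ /imsetP[a _ ->]; split; first exact: flag_complex_simplicial.
  by apply/finset.setIidPr; rewrite flag_complexU join0x.
- split.
  + by have := sph \bot%O; rewrite rk0 subr0.
  + by move=> _ /imsetP[a aA ->]; have := sph a; rewrite (rank_atom L_geometric aA).
  + by move=> B /intersection_flag_complex[G ->]; exists (r%:Z - (rk G)%:Z - 1).
  + exists flip_action.
      by apply: flag_complex_free => i j H; exact: (flag_block_unique F_flag).
    by move=> _ /imsetP[a _ ->]; exact: flag_complex_acts.
  + move=> B _ k /intersection_flag_complex[G ->] /imsetP[a aA ->] [n -> Gn] Ga.
    (* The dimension is given only through some homotopy equivalence; uniqueness ties it to the rank
       of [G], and joining an atom not below [G] raises that rank by exactly one. *)
    have -> : n = (r - rk G)%N.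
      exact: sphere_dimension_unique Gn (flag_complex_sphere R G).
    have aG : ~~ (a <= G)%O.
      apply: contra Ga => aG; apply/finset.setIidPl.
      by rewrite flag_complexU (join_l aG).
    have := sph (G `|` a)%O; rewrite -flag_complexU (rank_join_new_atom L_geometric) //.
    suff -> : r%:Z - (rk G).+1%:Z - 1 = (r - rk G)%N%:Z - 1 - 1 by [].
    rewrite -subzn; last by rewrite -rank_L; apply: (rank_le L_geometric); exact: lex1.
    by rewrite -addn1 PoszD opprD addrA.
Qed.

End FlagComplex.

Theorem theorem3p1 (R : realType) (d : Order.disp_t) (L : finTBLatticeType d)
    (rk : L -> nat) (r : nat) (F : 'I_r.+1 -> L)
    (L_geometric : geometric_lattice rk) (rank_L : rk \top%O = r)
    (F_flag : complete_flag F) :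
  [/\ homotopy_arrangement R (r%:Z - 1) (flag_complex F \bot%O)
        [set flag_complex F G | G in @atoms d L]%SET,
      forall G : L,
        homotopy_sphere R (flag_complex F G) (r%:Z - (rk G)%:Z - 1)
    & forall G H : L,
        (flag_complex F G :&: flag_complex F H)%SET
          = flag_complex F (G `|` H)%O].
Proof.
split.
- exact: (flag_complex_arrangement L_geometric rank_L F_flag).
- exact: (flag_complex_homotopy_sphere L_geometric rank_L F_flag).
- exact: flag_complexU.
Qed.
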